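(* Let $\alpha\in(0,1)$ be irrational, let $\theta\in[0,1)$, and let $2\le m\le n$ be integers. Then the $m\times n$ rectangles of the Sturmian word with slope $\alpha$ and intercept $\theta$ are balanced if and only if the Ostrowski representations of $m$ and $n$ with respect to $\alpha$ are of at least one of the following four shapes: (i) there is $M\ge 0$ with $m=\sum_{k=0}^M b_k q_k$ and $n=\sum_{\ell=M+1}^N b_\ell q_\ell$ (i.e. $b_k(m)=0$ for all $k>M$ and $b_k(n)=0$ for all $k\le M$); (ii) there is $M\ge0$ with $m=\sum_{k=0}^M b_kq_k$, $b_M(m)\neq 0$, and $n=q_M+\sum_{k=M+1+2t}^N b_kq_k$ for some $t\ge 0$ with $b_{M+1+2t}\neq0$ (i.e. $b_M(n)=1$, $b_k(n)=0$ for $k<M$ and for $M<k<M+1+2t$, and $b_{M+1+2t}(n)\ne0$); (iii) $m=q_M$ for some $M$, and $n=\sum_{\ell=0}^{M-1}b_\ell q_\ell+\sum_{\ell=M+2t}^N b_\ell q_\ell$ for some $t\ge0$ with $b_{M+2t}\neq 0$ (i.e. $b_k(n)=0$ for $M\le k<M+2t$ and $b_{M+2t}(n)\ne0$); (iv) $m=q_{M-1}+aq_M$ for some $M\ge1$ and $1\le a<a_{M+1}$, and $n=\sum_{k=0}^{M-1}b_kq_k+\sum_{k=M+1+2t}^N b_kq_k$ for some $t\ge0$ with $b_{M+1+2t}\ne0$ (i.e. $b_k(n)=0$ for $M\le k<M+1+2t$ and $b_{M+1+2t}(n)\ne0$).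
   Context: The Sturmian word $\mathbf a=a_1a_2a_3\cdots$ with slope $\alpha$ and intercept $\theta$ is defined by $a_j=\lfloor (j+1)\alpha+\theta\rfloor-\lfloor j\alpha+\theta\rfloor\in\{0,1\}$. For $i\ge1$ let $T(i,m,n)=\sum_{k=0}^{m-1}\sum_{\ell=0}^{n-1}a_{i+k+\ell}$ (the sum of the entries of the $m\times n$ submatrix of the Hankel matrix $(a_{k+\ell})$ with upper-left entry $a_i$). The $m\times n$ rectangles of $\mathbf a$ are balanced if there is an integer $c$ with $T(i,m,n)\in\{c,c+1\}$ for all $i\ge1$. Let $\alpha=[0;a_1,a_2,\dots]$ be the continued fraction expansion, $q_0=1$, $q_1=a_1$, $q_{k+1}=a_{k+1}q_k+q_{k-1}$ for $k\ge1$. Every positive integer $n$ has a unique Ostrowski representation $n=\sum_{k=0}^N b_kq_k$ with $0\le b_0\le a_1-1$, $0\le b_k\le a_{k+1}$ for $k\ge1$, and $b_{k-1}=0$ whenever $b_k=a_{k+1}$; $b_k(n)$ denotes the digit $b_k$ (zero for $k>N$). Writing $n=\sum_{k=L}^N b_kq_k$ always means this is the Ostrowski representation (so digits outside the displayed ranges are $0$), without requiring the extreme displayed digits to be nonzero. *)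

(* Defs.v *)
From HB Require Import structures.
From mathcomp Require Import all_boot all_order all_algebra.
From mathcomp Require Import boolp classical_sets reals.
From mathcomp Require Import zify.

Set Implicit Arguments.
Unset Strict Implicit.
Unset Printing Implicit Defensive.

Import Order.TTheory GRing.Theory Num.Theory.
Local Open Scope ring_scope.

(* Letters are indexed from j = 1; the value at j = 0 is never used. *)
Definition sturmian (R : realType) (alpha theta : R) (j : nat) : int :=
  Num.floor (j.+1%:R * alpha + theta) - Num.floor (j%:R * alpha + theta).

Definition rect_sum (w : nat -> int) (i m n : nat) : int :=
  \sum_(0 <= k < m) \sum_(0 <= l < n) w (i + k + l)%N.

Definition balanced_rectangles (w : nat -> int) (m n : nat) : Prop :=
  exists c : int, forall i : nat, (1 <= i)%N ->
    rect_sum w i m n = c \/ rect_sum w i m n = c + 1.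

(* Orbit of alpha under the Gauss map: for alpha = [0; a_1, a_2, ...] the k-th
   term is [0; a_(k+1), a_(k+2), ...]. *)
Fixpoint cf_tail (R : realType) (alpha : R) (k : nat) : R :=
  if k is k'.+1 then
    (cf_tail alpha k')^-1 - (Num.floor (cf_tail alpha k')^-1)%:~R
  else alpha.

(* The partial quotient a_k of alpha in (0, 1). *)
Definition cf_quot (R : realType) (alpha : R) (k : nat) : nat :=
  if k is k'.+1 then Num.truncn (cf_tail alpha k')^-1 else 0%N.

Fixpoint cf_den (R : realType) (alpha : R) (k : nat) : nat :=
  match k with
  | 0 => 1%N
  | 1 => cf_quot alpha 1
  | (k''.+1 as k').+1 =>
      (cf_quot alpha k * cf_den alpha k' + cf_den alpha k'')%N
  end.

Local Open Scope nat_scope.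

(* Digit sequences are total, vanishing beyond the top index N. *)
Definition ostrowski_rep (R : realType) (alpha : R) (n : nat)
    (b : nat -> nat) : Prop :=
  [/\ exists N, (forall k, N < k -> b k = 0) /\
        n = \sum_(0 <= k < N.+1) b k * cf_den alpha k,
      b 0 <= cf_quot alpha 1 - 1,
      forall k, 1 <= k -> b k <= cf_quot alpha k.+1
    & forall k, 1 <= k -> b k = cf_quot alpha k.+1 -> b k.-1 = 0].

(* The digit b_k(n) of the Ostrowski representation of n; the representation
   exists and is unique by ostrowski_rep_ex and ostrowski_rep_uniq below. *)
Definition ostrowski_digit (R : realType) (alpha : R) (n k : nat) : nat :=
  xget (fun=> 0) (ostrowski_rep alpha n : set (nat -> nat)) k.

Definition shape_i (R : realType) (alpha : R) (m n : nat) : Prop :=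
  exists M : nat,
    (forall k, M < k -> ostrowski_digit alpha m k = 0) /\
    (forall k, k <= M -> ostrowski_digit alpha n k = 0).

Definition shape_ii (R : realType) (alpha : R) (m n : nat) : Prop :=
  exists M t : nat,
    [/\ forall k, M < k -> ostrowski_digit alpha m k = 0,
        ostrowski_digit alpha m M <> 0,
        ostrowski_digit alpha n M = 1,
        forall k, k < M \/ M < k < M + 1 + 2 * t ->
          ostrowski_digit alpha n k = 0
      & ostrowski_digit alpha n (M + 1 + 2 * t) <> 0].

(* In shapes iii and iv the equations m = q_M and m = q_(M-1) + a q_M are
   required to be the Ostrowski representation of m. *)
Definition shape_iii (R : realType) (alpha : R) (m n : nat) : Prop :=
  exists M t : nat,
    [/\ ostrowski_rep alpha m (fun k => if k == M then 1 else 0),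
        forall k, M <= k < M + 2 * t -> ostrowski_digit alpha n k = 0
      & ostrowski_digit alpha n (M + 2 * t) <> 0].

Definition shape_iv (R : realType) (alpha : R) (m n : nat) : Prop :=
  exists M a t : nat,
    [/\ 1 <= M,
        1 <= a < cf_quot alpha M.+1,
        ostrowski_rep alpha m
          (fun k => if k == M.-1 then 1 else if k == M then a else 0),
        forall k, M <= k < M + 1 + 2 * t -> ostrowski_digit alpha n k = 0
      & ostrowski_digit alpha n (M + 1 + 2 * t) <> 0].

Section OstrowskiRepresentation.
Variables (R : realType) (alpha : R).
Hypotheses (alpha01 : (0 < alpha < 1)%R) (alphaI : irrational alpha).

Local Notation a := (cf_quot alpha).
Local Notation q := (cf_den alpha).

Lemma cf_tail_itv k :
  (0 < cf_tail alpha k < 1)%R /\ irrational (cf_tail alpha k).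
Proof.
elim: k => [//|k [/andP[x0 x1] xI]] /=.
set x := cf_tail alpha k in x0 x1 xI *.
have yI : irrational (x^-1 - (Num.floor x^-1)%:~R)%R.
  move=> [r _ rE]; apply: xI; exists (r + (Num.floor x^-1)%:~R)^-1%R => //.
  by rewrite fmorphV rmorphD /= ratr_int rE subrK invrK.
split=> //; apply/andP; split.
  rewrite lt_neqAle subr_ge0 floor_le andbT eq_sym.
  by apply/eqP => y0; apply: yI; exists 0%R; rewrite // rmorph0 y0.
by rewrite ltrBlDr addrC -[X in (_ + X)%R]/(1%:~R)%R -intrD floorD1_gt.
Qed.

Lemma cf_quot_gt0 k : 0 < a k.+1.
Proof.
have [/andP[x0 x1] _] := cf_tail_itv k.
by rewrite /= truncn_gt0 invf_ge1// ltW.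
Qed.

Lemma cf_denSS k : q k.+2 = a k.+2 * q k.+1 + q k.
Proof. by []. Qed.

Lemma cf_den_gt0 k : 0 < q k.
Proof.
elim/ltn_ind: k => -[|[|k]] IH //; first exact: cf_quot_gt0.
by rewrite cf_denSS addn_gt0 (IH k) ?orbT.
Qed.

Lemma cf_den_leS k : q k <= q k.+1.
Proof.
case: k => [|k]; first exact: cf_quot_gt0.
rewrite cf_denSS (leq_trans _ (leq_addr _ _))//.
by rewrite leq_pmull// cf_quot_gt0.
Qed.

Lemma cf_den_ge k : k <= q k.
Proof.
elim: k => // -[_|k IH]; first exact: cf_quot_gt0.
rewrite cf_denSS; have := cf_den_gt0 k; have := cf_quot_gt0 k.+1; nia.
Qed.

Definition ostrowski_adm (b : nat -> nat) : Prop :=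
  [/\ b 0 <= a 1 - 1, forall k, 1 <= k -> b k <= a k.+1
    & forall k, 1 <= k -> b k = a k.+1 -> b k.-1 = 0].

Let sumS (b : nat -> nat) K : \sum_(0 <= k < K.+1) b k * q k =
  \sum_(0 <= k < K) b k * q k + b K * q K.
Proof. by rewrite big_nat_recr. Qed.

Lemma ostrowski_sum_lt b K : ostrowski_adm b ->
  \sum_(0 <= k < K) b k * q k < q K.
Proof.
move=> [b0 bk bE]; elim/ltn_ind: K => -[|[|K]] IH.
- by rewrite big_geq.
- by rewrite big_nat1 muln1 -[q 1]/(a 1); have := cf_quot_gt0 0; lia.
have H0 := IH K (ltnW (ltnSn _)); have H1 := IH K.+1 (ltnSn _).
rewrite cf_denSS sumS.
have := bk K.+1 isT; rewrite leq_eqVlt => /orP[/eqP E|ltb].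
  rewrite sumS -[b K]/(b K.+1.-1) (bE K.+1 isT E) mul0n addn0 E.
  by rewrite [X in _ <= X]addnC ltn_add2r.
have : (b K.+1).+1 * q K.+1 <= a K.+2 * q K.+1 by rewrite leq_mul2r ltb orbT.
lia.
Qed.

Lemma ostrowski_adm_ex K n : n < q K ->
  exists b, [/\ ostrowski_adm b, forall k, K <= k -> b k = 0
    & n = \sum_(0 <= k < K) b k * q k].
Proof.
elim/ltn_ind: K n => -[|[|K]] IH n.
- case: n => // _; exists (fun=> 0); split=> //; last by rewrite big_geq.
- move=> na; exists (fun k => if k == 0 then n else 0); split.
  + split=> [|[]|[|[|k]] //]//.
      by change (n <= a 1 - 1); move: na; rewrite -[q 1]/(a 1); lia.
    by move=> _; change (0 = a 2 -> n = 0); have := cf_quot_gt0 1; lia.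
  + by case.
  + by rewrite big_nat1 muln1.
rewrite cf_denSS => nq.
have := ltn_mod n (q K.+1); have := divn_eq n (q K.+1).
rewrite cf_den_gt0; set d := n %/ _; set r := n %% _ => nE rq.
have da : d <= a K.+2.
  rewrite -ltnS ltn_divLR ?cf_den_gt0//.
  by apply: leq_trans nq _; rewrite mulSn addnC leq_add2r cf_den_leS.
have [c [[c0 ck cE] cz rE] cda] : exists2 c, [/\ ostrowski_adm c,
    forall k, K.+1 <= k -> c k = 0 & r = \sum_(0 <= k < K.+1) c k * q k] &
    (d = a K.+2 -> c K = 0).
  move: da; rewrite leq_eqVlt => /orP[/eqP dE|].
    have rK : r < q K by move: nq; rewrite nE dE; lia.
    have [c [ca cz rE]] := IH K (ltnW (ltnSn _)) r rK.
    exists c => [|_]; last exact: cz.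
    split=> // [k Kk|]; first by apply: cz; lia.
    by rewrite sumS (cz K)// mul0n addn0.
  move=> ltd; have [c [ca cz rE]] := IH K.+1 (ltnSn _) r rq.
  by exists c => // dE; lia.
exists (fun k => if k == K.+1 then d else c k); split.
- split=> // [k k1|k k1].
    by case: eqP => [->//|_]; exact: ck.
  case: eqP => [->|kK] E; first by rewrite -pred_Sn (ltn_eqF (ltnSn K)) cda.
  case: eqP => [kK'|_]; last exact: cE.
  by have := cf_quot_gt0 k; rewrite -E cz//; lia.
- by move=> k Kk; rewrite gtn_eqF// cz// ltnW.
- rewrite sumS eqxx nE addnC; congr (_ + _).
  rewrite rE; apply: eq_big_nat => k /andP[_ kK].
  by rewrite ltn_eqF.
Qed.

Lemma ostrowski_rep_ex n : exists b, ostrowski_rep alpha n b.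
Proof.
have [b [[b0 bk bE] bz nE]] := ostrowski_adm_ex (cf_den_ge n.+1).
exists b; split=> //; exists n; split=> // k; exact: bz.
Qed.

Lemma ostrowski_adm_inj b c K : ostrowski_adm b -> ostrowski_adm c ->
  \sum_(0 <= k < K) b k * q k = \sum_(0 <= k < K) c k * q k ->
  forall k, k < K -> b k = c k.
Proof.
move=> ba ca; elim: K => // K IH; rewrite !sumS.
have := ostrowski_sum_lt K ba; have := ostrowski_sum_lt K ca.
set B := \sum_(0 <= _ < _) _; set C := \sum_(0 <= _ < _) _ => Cq Bq E.
have bcK : b K = c K.
  have := congr1 (divn^~ (q K)) E.
  by rewrite !(addnC _ (_ * q K)) !divnMDl ?cf_den_gt0// !divn_small// !addn0.
move=> k; rewrite ltnS leq_eqVlt => /orP[/eqP->//|]; apply: IH.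
by move: E; rewrite bcK; lia.
Qed.

Lemma ostrowski_rep_uniq n b c :
  ostrowski_rep alpha n b -> ostrowski_rep alpha n c -> b = c.
Proof.
move=> [[N [bz bE]] b0 bk bN] [[P [cz cE]] c0 ck cP].
have sumE (f : nat -> nat) K L : K <= L -> (forall k, K <= k -> f k = 0) ->
    \sum_(0 <= k < L) f k * q k = \sum_(0 <= k < K) f k * q k.
  move=> KL fz; rewrite (big_cat_nat (leq0n K) KL)/=.
  rewrite [X in _ + X]big_nat_cond [X in _ + X]big1 ?addn0//.
  by move=> k /andP[/andP[Kk _] _]; rewrite fz.
apply/funext => k; apply: (@ostrowski_adm_inj b c (k + N.+1 + P.+1)) => //.
- rewrite (sumE b N.+1)//; last lia.
  by rewrite (sumE c P.+1)//; [rewrite -bE -cE|lia].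
- lia.
Qed.

Lemma ostrowski_digitP n : ostrowski_rep alpha n (ostrowski_digit alpha n).
Proof. exact: xgetPex (ostrowski_rep_ex n). Qed.

End OstrowskiRepresentation.

(* Main.v *)
(* The rectangle sum starting at [i] is a step function of [i alpha + theta]
   modulo 1 that drops at the points [- k alpha] and increases at the
   points [- (n + k) alpha], [k < m].  It takes two values iff these points
   interleave, i.e. iff it takes the same value at all the points [- k alpha];
   comparing consecutive [k], this says that [k alpha] and [(k - m) alpha] lie on
   the same side of [n alpha] (fractional parts, [0 < k < m]).
   Let r and s be the indices of the two neighbours of 0 among the [k alpha],
   [0 < k < m]; they are q_M and q_(M-1) + c q_M.  If m < r + s, the condition
   forces [n alpha] to be closer to an integer than q_M alpha, which gives shapes
   i and ii.  If m = r + s (two gap lengths), no [(n - k) alpha], [0 < k < m], may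
   fall in the arc between 0 and [- m alpha], and reading this on the Ostrowski
   digits of n gives shapes iii and iv (besides i and ii). *)

Require Import Defs.
From mathcomp Require Import all_boot all_order all_algebra.
From mathcomp Require Import boolp reals.
From mathcomp Require Import zify ring lra.

Set Implicit Arguments.
Unset Strict Implicit.
Unset Printing Implicit Defensive.

Import Order.TTheory GRing.Theory Num.Theory.

(** * Fractional parts and floors of differences *)

Section FractionalPart.
Local Open Scope ring_scope.
Variable R : realType.
Implicit Types (x z t : R) (p : int).

Definition frac x := x - (Num.floor x)%:~R.

Lemma frac_ge0 x : 0 <= frac x.
Proof. by rewrite subr_ge0 floor_le. Qed.

Lemma frac_lt1 x : frac x < 1.
Proof. by have := floorD1_gt x; rewrite /frac intrD; lra. Qed.

Lemma floor_eq x p : p%:~R <= x < p%:~R + 1 -> Num.floor x = p.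
Proof. by move=> ?; apply: floor_def; rewrite intrD. Qed.

Lemma frac_eq x z p : x = p%:~R + z -> 0 <= z < 1 -> frac x = z.
Proof.
move=> -> z01; rewrite /frac (@floor_eq _ p); last lra.
by rewrite addrC addKr.
Qed.

Lemma fracK x : x = (Num.floor x)%:~R + frac x.
Proof. by rewrite /frac addrC subrK. Qed.

Lemma frac_gt0 x : (forall p, x != p%:~R) -> 0 < frac x.
Proof. by move=> xI; rewrite lt_neqAle frac_ge0 eq_sym subr_eq0 xI. Qed.

Lemma fracN x : (forall p, x != p%:~R) -> frac (- x) = 1 - frac x.
Proof.
move=> xI; apply: (@frac_eq _ _ (- Num.floor x - 1)).
  by rewrite /frac rmorphB rmorphN /=; lra.
have := frac_gt0 xI; have := frac_lt1 x; lra.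
Qed.

Lemma frac_neq x t : (forall p, x - t != p%:~R) -> frac x != frac t.
Proof.
move=> xtI; apply/eqP => E; case/eqP: (xtI (Num.floor x - Num.floor t)).
by rewrite rmorphB /=; move: E; rewrite /frac; lra.
Qed.

(** [t - x] borrows 1 exactly when [frac t] is below [frac x], and [- x] always borrows because [x]
    is not an integer; the floors of [x] cancel and only the comparison remains. *)
Lemma floorB_frac x t : (forall p, x != p%:~R) -> frac x != frac t ->
  Num.floor (t - x) - Num.floor (- x) =
  Num.floor t + (frac x < frac t)%R%:R.
Proof.
move=> xI xt.
have -> : Num.floor (- x) = - Num.floor x - 1.
  apply: floor_eq; rewrite rmorphB rmorphN /=.
  by have := frac_gt0 xI; have := frac_lt1 x; rewrite /frac; lra.
have := frac_ge0 x; have := frac_lt1 x; have := frac_ge0 t; have := frac_lt1 t.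
case: (ltgtP (frac x) (frac t)) xt => // lt_xt _ t1 t0 x1 x0.
  rewrite (@floor_eq _ (Num.floor t - Num.floor x)); first by rewrite /=; lia.
  by rewrite rmorphB /=; rewrite /frac in lt_xt t1 t0 x1 x0; lra.
rewrite (@floor_eq _ (Num.floor t - Num.floor x - 1)); first by rewrite /=; lia.
by rewrite !rmorphB /=; rewrite /frac in lt_xt t1 t0 x1 x0; lra.
Qed.

(** One equation for each step from [- (k - 1) alpha] to [- k alpha], saying that [window_sum] does
    not change there ([window_sum_step]). *)
Definition same_side (alpha : R) (m n : nat) : Prop :=
  forall k : nat, (0 < k < m)%N ->
  (frac (k%:R * alpha) < frac (n%:R * alpha)) =
  (frac ((k%:R - m%:R) * alpha) < frac (n%:R * alpha)).

End FractionalPart.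

(** * Rectangle sums along the rotation by alpha *)

Section WindowSums.
Local Open Scope ring_scope.
Variables (R : realType) (alpha : R).

(** What remains of the double sum once the inner sum telescopes; it depends on [i] only through
    [x = i alpha + theta] modulo 1. *)
Definition window_sum (x : R) (m n : nat) : int :=
  \sum_(0 <= k < m) (Num.floor (x + (k + n)%:R * alpha) -
                     Num.floor (x + k%:R * alpha)).

Lemma rect_sum_sturmian (theta : R) i m n :
  rect_sum (sturmian alpha theta) i m n =
  window_sum (i%:R * alpha + theta) m n.
Proof.
apply: eq_big_nat => k _.
pose f l := Num.floor ((i + k + l)%:R * alpha + theta).
transitivity (\sum_(0 <= l < n) (f l.+1 - f l)).
  by apply: eq_big_nat => l _; rewrite /f addnS.
rewrite telescope_sumr// /f addn0.
by congr (_ - _); congr Num.floor; rewrite !natrD; ring.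
Qed.

Lemma window_sumDint x (p : int) m n :
  window_sum (p%:~R + x) m n = window_sum x m n.
Proof.
apply: eq_big_nat => k _.
have pz : p%:~R \is a @Num.int R by exact: intr_int.
by rewrite -!addrA !(floorDzr pz) /= intrKfloor; ring.
Qed.

(** Shifting [x] by [- alpha] shifts the index by one, so only the new first and the old last term
    survive. *)
Lemma window_sumB x m n : window_sum (x - alpha) m.+1 n - window_sum x m.+1 n =
  (Num.floor (x - alpha + n%:R * alpha) - Num.floor (x - alpha)) -
  (Num.floor (x + (m + n)%:R * alpha) - Num.floor (x + m%:R * alpha)).
Proof.
rewrite /window_sum big_nat_recl// big_nat_recr//= add0n mul0r addr0.
rewrite (_ : \sum_(0 <= i < m) _ = \sum_(0 <= k < m)
  (Num.floor (x + (k + n)%:R * alpha) - Num.floor (x + k%:R * alpha))).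
  by ring.
apply: eq_big_nat => k _.
by congr (_ - _); congr Num.floor; rewrite ?addSn -natr1; ring.
Qed.

Hypothesis irr : forall (j : nat) (p : int), (0 < j)%N ->
  j%:R * alpha != p%:~R.

Lemma irrB (a b : nat) (p : int) : a != b -> (a%:R - b%:R) * alpha != p%:~R.
Proof.
case: (ltngtP a b) => // ab _.
  apply: contra (irr (- p) (_ : 0 < b - a)%N); last by rewrite subn_gt0.
  by move=> /eqP E; rewrite natrB 1?ltnW// rmorphN /= -E; apply/eqP; ring.
apply: contra (irr p (_ : 0 < a - b)%N); last by rewrite subn_gt0.
by move=> /eqP E; rewrite natrB 1?ltnW// -E.
Qed.

(** By [window_sumB] the change is a difference of two floor increments; [floorB_frac] writes each
    as the floor of [n alpha] plus an indicator, and the floors cancel. *)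
Lemma window_sum_step m n k : (0 < k < m)%N -> (m <= n)%N ->
  (window_sum (- (k%:R * alpha)) m n == window_sum (- (k.-1%:R * alpha)) m n) =
  ((frac (k%:R * alpha) < frac (n%:R * alpha)) ==
   (frac ((k%:R - m%:R) * alpha) < frac (n%:R * alpha))).
Proof.
case: m => [|m]; first by rewrite ltn0 andbF.
case: k => [//|k]; rewrite ltnS => km mn /=.
rewrite -subr_eq0.
have -> : - (k.+1%:R * alpha) = - (k%:R * alpha) - alpha by rewrite -natr1; ring.
rewrite window_sumB.
have E1 := @floorB_frac _ (k.+1%:R * alpha) (n%:R * alpha)
  (fun p => irr p (isT : 0 < k.+1)%N).
have E2 := @floorB_frac _ ((k.+1%:R - m.+1%:R) * alpha) (n%:R * alpha).
rewrite (_ : - (k%:R * alpha) - alpha + n%:R * alpha =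
   n%:R * alpha - k.+1%:R * alpha); last by rewrite -natr1; ring.
rewrite (_ : - (k%:R * alpha) - alpha = - (k.+1%:R * alpha));
  last by rewrite -natr1; ring.
rewrite (_ : - (k%:R * alpha) + (m + n)%:R * alpha =
   n%:R * alpha - ((k.+1%:R - m.+1%:R) * alpha));
  last by rewrite natrD -!natr1; ring.
rewrite (_ : - (k%:R * alpha) + m%:R * alpha = 
   - ((k.+1%:R - m.+1%:R) * alpha)); last by rewrite -!natr1; ring.
rewrite E1; last first.
  by apply: frac_neq => p; rewrite -mulrBl; apply: irrB; lia.
rewrite E2; first by do 2![case: (_ < _)]; rewrite /=; lia.
  by move=> p; apply: irrB; lia.
apply: frac_neq => p.
rewrite (_ : _ - _ = (k.+1%:R - (m.+1 + n)%:R) * alpha).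
  by apply: irrB; lia.
by rewrite natrD; ring.
Qed.

Lemma window_sum_const m n : (0 < m <= n)%N -> same_side alpha m n <->
  (forall k, (k < m)%N ->
     window_sum (- (k%:R * alpha)) m n = window_sum 0 m n).
Proof.
move=> /andP[m0 mn]; split=> [H|H k /andP[k0 km]].
  elim=> [|k IH] km; first by rewrite mul0r oppr0.
  rewrite -IH; last lia.
  by apply/eqP; rewrite (@window_sum_step _ _ k.+1)//; apply/eqP/H.
by apply/eqP; rewrite -window_sum_step ?k0//; rewrite !H//; lia.
Qed.

(* Sliding [y] to the left, up to the nearest point of the form [- k alpha],
   changes no term [floor (y + k alpha)]; sliding it to the right changes
   exactly one of them. *)
Lemma window_sum_two_values m n y : (0 < m <= n)%N ->
  (forall k, (k < m)%N ->
     window_sum (- (k%:R * alpha)) m n = window_sum 0 m n) ->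
  window_sum y m n = window_sum 0 m n \/
  window_sum y m n = window_sum 0 m n + 1.
Proof.
case: m => // m mn H.
(* [F i] is the distance from [- i alpha] rightwards to [y] on the circle: its minimiser is the left
   neighbour of [y], its maximiser the right one. *)
pose F (i : 'I_m.+1) := frac (y + i%:R * alpha).
have ge : (window_sum 0 m.+1 n <= window_sum y m.+1 n).
  case: (@arg_minP _ _ _ (ord0 : 'I_m.+1) predT F isT) => k _ kmin.
  rewrite -(H k)// -(window_sumDint (- (k%:R * alpha)) (Num.floor (y + k%:R * alpha))).
  have -> : (Num.floor (y + k%:R * alpha))%:~R - k%:R * alpha = y - F k.
    by rewrite /F /frac; ring.
  rewrite /window_sum !big_mkord; apply: ler_sum => i _.
  have Fk0 := frac_ge0 (y + k%:R * alpha); have Fki := kmin i isT.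
  apply: lerB; first by apply: le_floor; rewrite lerD2r gerBl.
  rewrite floor_ge_int; move: Fki; rewrite {2}/F /frac; lra.
have le : (window_sum y m.+1 n <= window_sum 0 m.+1 n + 1).
  case: (@arg_maxP _ _ _ (ord0 : 'I_m.+1) predT F isT) => k _ kmax.
  rewrite -(H k)// -(window_sumDint (- (k%:R * alpha)) (Num.floor (y + k%:R * alpha) + 1)).
  have -> : (Num.floor (y + k%:R * alpha) + 1)%:~R - k%:R * alpha
     = y + 1 - F k by rewrite /F /frac intrD; ring.
  rewrite /window_sum !big_mkord (bigD1 k)//= [X in _ <= X + 1](bigD1 k)//=.
  rewrite [X in _ <= X]addrAC; apply: lerD.
    have -> : y + 1 - F k + k%:R * alpha = (Num.floor (y + k%:R * alpha) + 1)%:~R.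
      by rewrite /F /frac intrD; ring.
    rewrite intrKfloor.
    have : Num.floor (y + (k + n)%:R * alpha) <=
       Num.floor (y + 1 - F k + (k + n)%:R * alpha).
      by apply: le_floor; have := frac_lt1 (y + k%:R * alpha); rewrite /F; lra.
    lia.
  apply: ler_sum => i ik; apply: lerB.
    by apply: le_floor; have := frac_lt1 (y + k%:R * alpha); rewrite /F; lra.
  rewrite -ltzD1 floor_lt_int intrD.
  have : F i != F k.
    apply: frac_neq => p.
    rewrite (_ : _ - _ = (i%:R - k%:R) * alpha); last by ring.
    exact: irrB.
  have : F i <= F k := kmax i isT; rewrite le_eqVlt => /orP[/eqP->|]; first by rewrite eqxx.
  by move=> + _; rewrite {1}/F /frac; lra.
lia.
Qed.

(** Within [d] of [- k alpha] only the floor of [y + k alpha] can jump, from -1 to 0, and it occurs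
    only with a minus sign because [k < n]. *)
Lemma window_sum_near m n k (d u : R) : (k < m <= n)%N -> d <= 1 ->
  (forall (j : nat) (p : int), (0 < j < m + n)%N ->
     d <= `|j%:R * alpha - p%:~R|) ->
  0 < u < d ->
  window_sum (- (k%:R * alpha) - u) m n =
    window_sum (- (k%:R * alpha)) m n + 1 /\
  forall v, 0 <= v < d ->
  window_sum (- (k%:R * alpha) + v) m n = window_sum (- (k%:R * alpha)) m n.
Proof.
move=> /andP[km mn] d1 sep u0d.
have sep2 (a b : nat) (p : int) : (a < m + n)%N -> (b < m + n)%N -> a != b ->
    d <= `|(a%:R - b%:R) * alpha - p%:~R|.
  move=> aN bN; case: (ltngtP a b) => // ab _.
    rewrite -normrN (_ : - _ = (b - a)%:R * alpha - (- p)%:~R).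
      by apply: sep; lia.
    by rewrite natrB 1?ltnW// rmorphN /=; ring.
  rewrite (_ : _ - _ = (a - b)%:R * alpha - p%:~R); first by apply: sep; lia.
  by rewrite natrB 1?ltnW.
have sepF (a b : nat) : (a < m + n)%N -> (b < m + n)%N -> a != b ->
    d <= frac ((a%:R - b%:R) * alpha) <= 1 - d.
  move=> aN bN ab; set x := (_ * alpha).
  have := sep2 a b (Num.floor x) aN bN ab.
  have := sep2 a b (Num.floor x + 1) aN bN ab.
  rewrite -/x intrD.
  have := frac_ge0 x; have := frac_lt1 x; rewrite /frac => x1 x0.
  by rewrite ler0_norm ?ger0_norm; lra.
have shift (a : nat) w : (a < m + n)%N -> a != k -> - d < w < d ->
    Num.floor (- (k%:R * alpha) + w + a%:R * alpha) =
    Num.floor (- (k%:R * alpha) + a%:R * alpha).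
  move=> aN ak wd.
  rewrite (_ : - (k%:R * alpha) + w + a%:R * alpha = (a%:R - k%:R) * alpha + w);
    last by ring.
  rewrite (_ : - (k%:R * alpha) + a%:R * alpha = (a%:R - k%:R) * alpha);
    last by ring.
  have := sepF a k aN _ ak; rewrite /frac => /(_ ltac:(lia)) F.
  by apply: floor_eq; lra.
split=> [|v vd].
  rewrite /window_sum (@big_cat_nat _ _ _ k)//=; last lia.
  rewrite [X in _ = X + 1](@big_cat_nat _ _ _ k)//=; last lia.
  rewrite (@big_ltn _ _ _ k)// [X in _ = _ + X + 1](@big_ltn _ _ _ k)//=.
  have E1 : Num.floor (- (k%:R * alpha) - u + k%:R * alpha) = -1.
    by apply: floor_eq; rewrite rmorphN /=; lra.
  rewrite E1 addNr floor0 shift; [|lia|lia|lra].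
  set A := \sum_(0 <= _ < k) _; set A' := \sum_(0 <= _ < k) _.
  set B := \sum_(k.+1 <= _ < m) _; set B' := \sum_(k.+1 <= _ < m) _.
  have -> : A = A'.
    by apply: eq_big_nat => i ik; rewrite !shift//; first [lia|lra].
  have -> : B = B'.
    by apply: eq_big_nat => i ik; rewrite !shift//; first [lia|lra].
  by ring.
apply: eq_big_nat => i im; rewrite shift; [|lia|lia|lra].
congr (_ - _); have [->|ik] := eqVneq i k; last by apply: shift; [lia| |lra].
rewrite addNr floor0; apply: floor_eq; lra.
Qed.

(* The multiples of [c] move around the circle by steps of size [e < d], hence
   approach every point within [d] on both sides. *)
Lemma balanced_same_side (theta d e : R) (c : nat) (p : int) m n :
  (0 < m <= n)%N -> d <= 1 ->
  (forall (j : nat) (p : int), (0 < j < m + n)%N ->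
     d <= `|j%:R * alpha - p%:~R|) ->
  c%:R * alpha - p%:~R = e -> 0 < e < d ->
  balanced_rectangles (sturmian alpha theta) m n <-> same_side alpha m n.
Proof.
move=> mn d1 sep cE ed; rewrite window_sum_const//; split; last first.
  move=> H; exists (window_sum 0 m n) => i _.
  by rewrite rect_sum_sturmian; exact: window_sum_two_values.
case=> C CE.
suff key k : (k < m)%N -> window_sum (- (k%:R * alpha)) m n = C.
  move=> k km; rewrite key//.
  by have := key 0 ltac:(lia); rewrite mul0r oppr0.
move=> km; have kmn : (k < m <= n)%N by rewrite km; case/andP: mn.
pose z := theta + k%:R * alpha.
(* The target is [P - k alpha]. The offset 2 makes the number [l] of steps needed to reach it at
   least 2, so that both [l - 1] and [l] steps give a positive starting index. *)
pose P := Num.floor z + 2.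
pose l := Num.ceil ((P%:~R - z) / e).
have e0 : 0 < e by case/andP: ed.
have /andP[] := ceil_itv ((P%:~R - z) / e); rewrite -/l.
rewrite ler_pdivrMr// ltr_pdivlMr// rmorphB /= => l1 l2.
have := floor_itv z; rewrite intrD => z1.
have l3 : 2 <= l.
  rewrite -ltzD1 -subr_gt0.
  rewrite -(@ltr0z R) !rmorphD rmorphN /=.
  rewrite ltNge; apply/negP => l4.
  have : l%:~R * e <= 1 * e by rewrite ler_pM2r //; lra.
  rewrite /P intrD in l2; lra.
have orbit (w : nat) : (0 < w)%N ->
   (w * c)%:R * alpha + theta =
   (w%:R * p%:~R + P%:~R) + (- (k%:R * alpha) + (w%:R * e + z - P%:~R)).
  by move=> _; rewrite -cE natrM /z; ring.
have c0 : (0 < c)%N.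
  case: (c) cE => // E; rewrite mul0r in E.
  have p0 : - p%:~R = e by lra.
  have : 0 < - p by rewrite -(@ltr0z R) rmorphN /= p0.
  move=> ?; have : (1 : int)%:~R <= (- p)%:~R :> R by rewrite ler_int; lia.
  rewrite rmorphN /= p0; lra.
have [l' l'E] : exists l' : nat, l = l'.+2 :> int.
  by exists (`|l| - 2)%N; lia.
rewrite l'E in l1 l2 l3.
have u1 : 0 < - (l'.+1%:R * e + z - P%:~R) < d.
  by rewrite -!natr1 in l1 l2 *; lra.
have v1 : 0 <= (l'.+2%:R * e + z - P%:~R) < d.
  by rewrite -!natr1 in l1 l2 *; lra.
have [kl kr] := @window_sum_near m n k d _ kmn d1 sep u1.
rewrite opprK in kl; have {}kr := kr _ v1.
have intE (w : nat) : w%:R * p%:~R + P%:~R = (w%:Z * p + P)%:~R :> R.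
  by rewrite [in RHS]intrD intrM.
(* Just before and just after the target the sums differ by 1 and both lie in {[C], [C + 1]}, so the
   lower one, which is the value at [- k alpha], is [C]. *)
have T1 := CE (l'.+1 * c)%N ltac:(by rewrite muln_gt0).
have T2 := CE (l'.+2 * c)%N ltac:(by rewrite muln_gt0).
rewrite rect_sum_sturmian orbit// intE window_sumDint kl in T1.
rewrite rect_sum_sturmian orbit// intE window_sumDint kr in T2.
by move: T1 T2; clear; lia.
Qed.

(** Negation reflects the circle and reverses both comparisons, ties being excluded by
    irrationality. This allows [alpha] to be replaced by [(-1)^M alpha]. *)
Lemma same_sideN m n : (0 < m <= n)%N ->
  same_side alpha m n <-> same_side (- alpha) m n.
Proof.
move=> mn.
suff E k : (0 < k < m)%N ->
    (frac (k%:R * - alpha) < frac (n%:R * - alpha)) =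
      ~~ (frac (k%:R * alpha) < frac (n%:R * alpha)) /\
    (frac ((k%:R - m%:R) * - alpha) < frac (n%:R * - alpha)) =
      ~~ (frac ((k%:R - m%:R) * alpha) < frac (n%:R * alpha)).
  split=> H k km; have [E1 E2] := E k km.
    by rewrite E1 E2 H.
  by apply: negb_inj; rewrite -E1 -E2 H.
move=> km; rewrite !mulrN !fracN; last 3 first.
1-3: by move=> p; first [apply: irr; lia|apply: irrB; lia].
rewrite !ltrD2l !ltrN2 -!leNgt !lt_neqAle.
split; rewrite andb_idl// => _; apply: frac_neq => p.
  by rewrite -mulrBl; apply: irrB; lia.
rewrite (_ : _ - _ = ((n + m)%:R - k%:R) * alpha); last by rewrite natrD; ring.
by apply: irrB; lia.
Qed.

End WindowSums.

(** * Neighbours of 0 and the resulting gap conditions *)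

Section Neighbours.
Local Open Scope ring_scope.
Variable R : realType.

(** The vectors [(r, pr)] and [(s, ps)] form a basis of Z^2. In coordinates [x], [y] the error is
    [x dr - y ds], and [0 < k < r + s] prevents [x], [y] from being both positive or both
    nonpositive. *)
Lemma unimodular_gap (beta dr ds : R) (r s : nat) (pr ps : int) :
  r%:R * beta - pr%:~R = dr -> s%:R * beta - ps%:~R = - ds ->
  0 < dr -> 0 < ds -> (r%:Z * ps - s%:Z * pr) ^+ 2 = 1 ->
  forall (k : nat) (p : int), (0 < k < r + s)%N ->
  k%:R * beta - p%:~R <= - ds \/ dr <= k%:R * beta - p%:~R.
Proof.
move=> rE sE dr0 ds0 det k p krs.
(* Cramer's rule; [D] is its own inverse, its square being 1. *)
pose D := r%:Z * ps - s%:Z * pr.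
pose x := D * (k%:Z * ps - p * s%:Z); pose y := D * (r%:Z * p - k%:Z * pr).
have kE : k%:Z = x * r%:Z + y * s%:Z.
  by rewrite -[LHS]mul1r -det /x /y /D; ring.
have pE : p = x * pr + y * ps by rewrite -[LHS]mul1r -det /x /y /D; ring.
have kR : k%:R = x%:~R * r%:R + y%:~R * s%:R :> R.
  by rewrite -[LHS]/((k%:Z)%:~R) kE intrD !intrM.
have -> : k%:R * beta - p%:~R = x%:~R * dr - y%:~R * ds.
  rewrite kR pE intrD !intrM -rE -[ds]opprK -sE; ring.
have [x0|x0] := lerP x 0; last have [y0|y0] := lerP y 0.
- have y1 : 1 <= y.
    by rewrite leNgt; apply/negP => y1; clear -kE krs x0 y1; nia.
  left; have xR : x%:~R * dr <= 0.
    by rewrite pmulr_lle0// lerz0.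
  have yR : 1 * ds <= y%:~R * ds by rewrite ler_pM2r// ler1z.
  by move: xR yR; clear; lra.
- right; have xR : 1 * dr <= x%:~R * dr by rewrite ler_pM2r// ler1z; lia.
  have yR : y%:~R * ds <= 0 by rewrite pmulr_lle0// lerz0.
  by move: xR yR; clear; lra.
by exfalso; clear -kE krs x0 y0; nia.
Qed.

Lemma int_eq0 (w : int) : - 1 < (w%:~R : R) < 1 -> w = 0.
Proof.
move=> w1; have : (- 1)%:~R < (w%:~R : R) < 1%:~R by rewrite rmorphN.
by rewrite !ltr_int; lia.
Qed.

(** All [k alpha] and [(k - m) alpha] with [0 < k < m] keep distance [d] from the integers, so
    [n alpha], being closer, has them all on one side. *)
Lemma same_side_close (alpha d : R) (m n : nat) (p0 : int) :
  (forall (k : nat) (p : int), (0 < k < m)%N ->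
     d <= `|k%:R * alpha - p%:~R|) ->
  `|n%:R * alpha - p0%:~R| < d -> same_side alpha m n.
Proof.
move=> far; rewrite ltr_norml => near k km.
have fracI x : (forall p : int, d <= `|x - p%:~R|) -> d <= frac x <= 1 - d.
  move=> xd; have := xd (Num.floor x); have := xd (Num.floor x + 1).
  have := frac_ge0 x; have := frac_lt1 x; rewrite /frac intrD => x1 x0.
  by rewrite ler0_norm ?ger0_norm; lra.
have k1 := fracI _ (fun p => far k p km).
have k2 : d <= frac ((k%:R - m%:R) * alpha) <= 1 - d.
  apply: fracI => p; rewrite -normrN.
  rewrite (_ : - _ = (m - k)%:R * alpha - (- p)%:~R); first by apply: far; lia.
  by rewrite natrB ?rmorphN /=; [ring|lia].
have := frac_lt1 (k%:R * alpha) => k3.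
have [n0|n0] := lerP 0 (n%:R * alpha - p0%:~R).
  have -> : frac (n%:R * alpha) = n%:R * alpha - p0%:~R.
    by apply: (@frac_eq _ _ _ p0); [ring|lra].
  by rewrite !ltNge; congr (~~ _); apply/idP/idP => _; lra.
have -> : frac (n%:R * alpha) = n%:R * alpha - p0%:~R + 1.
  by apply: (@frac_eq _ _ _ (p0 - 1)); [rewrite rmorphB /=; ring|lra].
by apply/idP/idP => _; lra.
Qed.

Variables (beta dr ds : R) (r s : nat) (pr ps : int).
Hypothesis irr : forall (j : nat) (p : int), (0 < j)%N ->
  j%:R * beta != p%:~R.
Hypothesis rE : r%:R * beta - pr%:~R = dr.
Hypothesis sE : s%:R * beta - ps%:~R = - ds.
Hypothesis gap : forall (k : nat) (p : int), (0 < k < r + s)%N ->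
  k%:R * beta - p%:~R <= - ds \/ dr <= k%:R * beta - p%:~R.
Hypotheses (dr0 : 0 < dr) (ds0 : 0 < ds).

Lemma frac_gap k : (0 < k < r + s)%N -> dr <= frac (k%:R * beta) <= 1 - ds.
Proof.
move: (dr0) (ds0) => dr1 ds1 krs; have := gap (Num.floor (k%:R * beta)) krs.
have := gap (Num.floor (k%:R * beta) + 1) krs.
rewrite intrD; have := frac_ge0 (k%:R * beta); have := frac_lt1 (k%:R * beta).
by rewrite /frac => x1 x0 [] g1 [] g2; lra.
Qed.

Lemma frac_gapN k : (0 < k < r + s)%N -> ds <= frac (- (k%:R * beta)) <= 1 - dr.
Proof.
move=> krs; rewrite fracN; first by have := frac_gap krs; lra.
by move=> p; apply: irr; lia.
Qed.

(** Otherwise [dr < t <= 1 - dr]. The condition at [m - r] puts [(m - r) beta] at or after [t], and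
    the conditions at [r] and [m - s] put [(m - s) beta] before [t]; yet the latter lies [dr + ds]
    to the right of the former, and the gap at [m] excludes wrapping around. *)
Lemma same_side_three_gaps m n : (0 < r < m)%N -> (0 < s < m)%N ->
  (m < r + s)%N -> (m <= n)%N ->
  same_side beta m n -> exists p : int, `|n%:R * beta - p%:~R| < dr.
Proof.
move: (dr0) (ds0) => dr1 ds1 rm sm mrs mn ss; set t := frac (n%:R * beta).
have [rm' sm'] : (r <= m)%N /\ (s <= m)%N by clear -rm sm; lia.
have mr0 : (0 < m - r < m)%N by clear -rm sm; lia.
have ms0 : (0 < m - s < m)%N by clear -rm sm; lia.
have [r1 s1] : (0 < r < r + s)%N /\ (0 < s < r + s)%N by clear -rm sm; lia.
have mr1 : (0 < m - r < r + s)%N by clear -rm sm mrs; lia.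
have m1 : (0 < m < r + s)%N by clear -rm sm mrs; lia.
have nr : n != r by clear -rm mn; lia.
have tE : n%:R * beta = (Num.floor (n%:R * beta))%:~R + t := fracK _.
have t0 : 0 <= t := frac_ge0 _; have t1 : t < 1 := frac_lt1 _.
have rI : dr <= frac (r%:R * beta) <= 1 - ds by exact: frac_gap.
have {}rI : frac (r%:R * beta) = dr /\ dr <= 1 - ds.
  by split; last lra; apply: (@frac_eq _ _ _ pr); [rewrite -rE; ring|lra].
case: rI => rI drs.
have NrI : frac ((r%:R * - beta)) = 1 - dr.
  by rewrite mulrN fracN ?rI// => p; apply: irr; case/andP: rm.
have NsI : frac ((s%:R * - beta)) = ds.
  by apply: (@frac_eq _ _ _ (- ps)); [rewrite rmorphN /= -[ds]opprK -sE; ring|lra].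
have [tr|tr] := lerP t dr.
  exists (Num.floor (n%:R * beta)); rewrite -[_ * _ - _]/t ger0_norm//.
  rewrite lt_neqAle tr andbT -rI; apply: frac_neq => p.
  by rewrite -mulrBl; exact: irrB.
have [tr'|tr'] := ltrP (1 - dr) t.
  exists (Num.floor (n%:R * beta) + 1); rewrite intrD ltr_norml; lra.
have mr : t <= frac ((m - r)%:R * beta).
  have := ss (m - r)%N; rewrite (_ : (_ - m%:R) * beta = r%:R * - beta).
    by rewrite NrI [1 - dr < _]ltNge tr' leNgt => ->//.
  by rewrite natrB//; ring.
have ms : frac ((m - s)%:R * beta) < t.
  have := ss (m - s)%N; rewrite (_ : (_ - m%:R) * beta = s%:R * - beta).
    rewrite NsI => ->//.
    apply: (@le_lt_trans _ _ (frac ((r%:R - m%:R) * beta))); last first.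
      by rewrite -ss ?rI.
    rewrite (_ : _ * beta = - ((m - r)%:R * beta)).
      suff /andP[] : ds <= frac (- ((m - r)%:R * beta)) <= 1 - dr by [].
      exact: frac_gapN.
    by rewrite natrB//; ring.
  by rewrite natrB//; ring.
set x := frac _ in mr.
have xE : (m - r)%:R * beta = (Num.floor ((m - r)%:R * beta))%:~R + x := fracK _.
have x1 : x < 1 := frac_lt1 _.
set F := Num.floor _ in xE.
have mE : m%:R * beta = F%:~R + x + pr%:~R + dr.
  by rewrite -xE natrB// -rE; ring.
have msE : (m - s)%:R * beta = F%:~R + x + pr%:~R + dr - ps%:~R + ds.
  by rewrite natrB// mulrBl mE -[ds]opprK -sE; ring.
have [] := @gap m (F + pr + 1) m1; rewrite mE !intrD; last lra.
move=> mp; have {}mp : x + dr + ds <= 1 by lra.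
suff E : frac ((m - s)%:R * beta) = x + dr + ds by lra.
apply: (@frac_eq _ _ _ (F + pr - ps)).
  by rewrite msE rmorphB rmorphD /=; ring.
rewrite lt_neqAle mp andbT; apply/andP; split; first lra.
apply/eqP => E; case/eqP: (@irr (m - s)%N (F + pr - ps + 1) ltac:(by case/andP: ms0)).
by rewrite msE !intrD rmorphN /=; lra.
Qed.

(** Modulo 1, [(r + s) beta] is [dr - ds], so [(k - (r + s)) beta] lies [ds - dr] to the right of
    [k beta]; the condition says that [n beta] does not separate the two. *)
Lemma same_side_two_gaps n : (0 < r)%N -> (0 < s)%N -> (r + s <= n)%N ->
  dr < ds ->
  same_side beta (r + s) n <-> forall (k : nat) (p : int), (0 < k < r + s)%N ->
    ~ (0 < (n%:R - k%:R) * beta - p%:~R < ds - dr).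
Proof.
move: (dr0) (ds0) => dr1 ds1 r0 s0 rsn drs; set t := frac (n%:R * beta).
pose Fn := Num.floor (n%:R * beta).
have tE : n%:R * beta = Fn%:~R + t := fracK _.
have t0 : 0 <= t := frac_ge0 _; have t1 : t < 1 := frac_lt1 _.
suff key k : (0 < k < r + s)%N ->
    ((frac (k%:R * beta) < t) = (frac ((k%:R - (r + s)%:R) * beta) < t)) <->
    (forall p : int, ~ (0 < (n%:R - k%:R) * beta - p%:~R < ds - dr)).
  split=> [ss k p km|H k km]; first exact: (proj1 (key k km) (ss k km)).
  by apply: (proj2 (key k km)) => p; exact: H.
move=> km; set x := frac (k%:R * beta).
pose Fk := Num.floor (k%:R * beta).
have xE : k%:R * beta = Fk%:~R + x := fracK _.
have /andP[x1 x2] : dr <= x <= 1 - ds by exact: frac_gap.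
have E : frac ((k%:R - (r + s)%:R) * beta) = x + (ds - dr).
  apply: (@frac_eq _ _ _ (Fk - pr - ps)); last lra.
  by rewrite mulrBl xE !rmorphB /= natrD -rE -[ds]opprK -sE; ring.
have tx : t != x + (ds - dr).
  rewrite -E; apply: frac_neq => p.
  rewrite (_ : _ - _ = ((n + (r + s))%:R - k%:R) * beta).
    by apply: irrB => //; clear -km rsn; lia.
  by rewrite [in RHS]natrD; ring.
rewrite E; split=> [ss p|H].
  rewrite mulrBl tE xE => H.
  pose w := p - Fn + Fk.
  have wE : t - x = (t - x - w%:~R) + w%:~R by ring.
  have w1 : 0 < t - x - w%:~R < ds - dr.
    by rewrite /w rmorphD rmorphB /=; lra.
  have w0 : w = 0 by apply: int_eq0; lra.
  move: ss; rewrite w0 subr0 in w1.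
  by rewrite (_ : (x < t) = true); [move=> /esym xt; lra|apply/idP; lra].
apply/idP/idP => [xt|]; last lra.
rewrite ltNge le_eqVlt (negPf tx) /=; apply/negP => tx'.
apply: (H (Fn - Fk)).
by rewrite mulrBl tE xE rmorphB /=; lra.
Qed.

End Neighbours.

(** * Convergents and best approximation *)

Section ContinuedFraction.
Local Open Scope ring_scope.
Variables (R : realType) (alpha : R).

(* Convergents indexed from -1: [cf_q k] is q_(k-1), [cf_p k] is p_(k-1) and
   [cf_err k] is |q_(k-1) alpha - p_(k-1)|. *)
Definition cf_q (k : nat) : nat := if k is k'.+1 then cf_den alpha k' else 0.

Fixpoint cf_p (k : nat) : int :=
  match k with
  | 0 => 1
  | 1 => 0
  | (k''.+1 as k').+1 => (cf_quot alpha k')%:Z * cf_p k' + cf_p k''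
  end.

Fixpoint cf_err (k : nat) : R :=
  match k with
  | 0 => 1
  | 1 => alpha
  | (k''.+1 as k').+1 => cf_err k'' - (cf_quot alpha k')%:R * cf_err k'
  end.

(* (-1)^M alpha, so that q_M times it lies just above an integer. *)
Definition cf_sgn (M : nat) : R := (- 1) ^+ M * alpha.

Hypotheses (alpha01 : 0 < alpha < 1) (alphaI : irrational alpha).

Lemma cf_qSS k : cf_q k.+2 = (cf_quot alpha k.+1 * cf_q k.+1 + cf_q k)%N.
Proof. by case: k => [|k] //=; rewrite muln1 addn0. Qed.

Lemma cf_pSS k : cf_p k.+2 = (cf_quot alpha k.+1)%:Z * cf_p k.+1 + cf_p k.
Proof. by []. Qed.

Lemma cf_errSS k :
  cf_err k.+2 = cf_err k - (cf_quot alpha k.+1)%:R * cf_err k.+1.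
Proof. by []. Qed.

(** Links the recursion to the Gauss map: the errors are products of tails in (0, 1), hence positive
    and decreasing. *)
Lemma cf_errS k : cf_err k.+1 = cf_err k * cf_tail alpha k.
Proof.
elim: k => [|k IH]; first by rewrite mul1r.
have [/andP[x0 x1] _] := cf_tail_itv alpha01 alphaI k.
have -> : cf_tail alpha k.+1 =
    (cf_tail alpha k)^-1 - (cf_quot alpha k.+1)%:R.
  congr (_ - _); rewrite /= truncn_floor invr_ge0 ltW// natr_absz ger0_norm//.
  by rewrite floor_ge0 invr_ge0 ltW.
by rewrite cf_errSS mulrBr IH mulfK ?gt_eqF// [X in _ - X = _]mulrC.
Qed.

Lemma cf_err_gt0 k : 0 < cf_err k.
Proof.
elim: k => [|k IH]; first exact: ltr01.
have [/andP[x0 x1] _] := cf_tail_itv alpha01 alphaI k.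
by rewrite cf_errS mulr_gt0.
Qed.

Lemma cf_err_ltS k : cf_err k.+1 < cf_err k.
Proof.
have [/andP[x0 x1] _] := cf_tail_itv alpha01 alphaI k.
by rewrite cf_errS gtr_pMr ?cf_err_gt0.
Qed.

Lemma cf_err_le1 k : cf_err k <= 1.
Proof.
by elim: k => // k; apply: le_trans; apply: ltW; exact: cf_err_ltS.
Qed.

Lemma cf_errE k :
  (- 1) ^+ k * ((cf_q k)%:R * alpha - (cf_p k)%:~R) = - cf_err k.
Proof.
suff [] : (- 1) ^+ k * ((cf_q k)%:R * alpha - (cf_p k)%:~R) = - cf_err k /\
  (- 1) ^+ k.+1 * ((cf_q k.+1)%:R * alpha - (cf_p k.+1)%:~R) = - cf_err k.+1
  by [].
elim: k => [|k [IH0 IH1]].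
  by split; rewrite /= ?expr0 ?expr1; ring.
split=> //; rewrite cf_qSS cf_pSS cf_errSS opprB.
rewrite natrD natrM intrD intrM -[in RHS](opprK (cf_err k)) -IH0.
rewrite -[in RHS](opprK (cf_err k.+1)) -IH1 !exprS -pmulrn; ring.
Qed.

Lemma cf_q_cf_sgn M : (cf_q M)%:R * cf_sgn M - ((- 1) ^+ M * cf_p M)%:~R
  = - cf_err M.
Proof. by rewrite -cf_errE /cf_sgn intrM rmorphXn /= rmorphN /=; ring. Qed.

Lemma cf_qS_cf_sgn M :
  (cf_q M.+1)%:R * cf_sgn M - ((- 1) ^+ M * cf_p M.+1)%:~R = cf_err M.+1.
Proof.
rewrite -[RHS]opprK -cf_errE /cf_sgn exprS intrM rmorphXn /= rmorphN /=; ring.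
Qed.

Lemma cf_q_add_cf_sgn M c : (cf_q M + c * cf_q M.+1)%:R * cf_sgn M -
    ((- 1) ^+ M * (cf_p M + c%:Z * cf_p M.+1))%:~R =
  - (cf_err M - c%:R * cf_err M.+1).
Proof.
rewrite natrD natrM opprB -cf_qS_cf_sgn -[X in _ = _ - X]opprK -cf_q_cf_sgn.
by move: ((- 1) ^+ M : int) => S; ring.
Qed.

Lemma cf_det k :
  ((cf_q k)%:Z * cf_p k.+1 - (cf_q k.+1)%:Z * cf_p k) ^+ 2 = 1.
Proof.
elim: k => [|k <-]; first by rewrite /=; ring.
by rewrite cf_qSS cf_pSS PoszD PoszM; ring.
Qed.

Lemma cf_q_gt0 k : (0 < cf_q k.+1)%N.
Proof. exact: cf_den_gt0. Qed.

Lemma cf_q_leS k : (cf_q k <= cf_q k.+1)%N.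
Proof. by case: k => // k; exact: cf_den_leS. Qed.

Lemma cf_err_sub_gt0 M c : (c <= cf_quot alpha M.+1)%N ->
  0 < cf_err M - c%:R * cf_err M.+1.
Proof.
move=> ca; apply: lt_le_trans (cf_err_gt0 M.+2) _.
by rewrite cf_errSS lerD2l lerN2 ler_pM2r ?cf_err_gt0// ler_nat.
Qed.

(** Adding [c] times one convergent vector to the previous one keeps the determinant, so
    [unimodular_gap] applies; the bound on [c] keeps the second error positive. *)
Lemma cf_gap M c : (c <= cf_quot alpha M.+1)%N ->
  forall (k : nat) (p : int),
  (0 < k < cf_q M.+1 + (cf_q M + c * cf_q M.+1))%N ->
  k%:R * cf_sgn M - p%:~R <= - (cf_err M - c%:R * cf_err M.+1) \/
  cf_err M.+1 <= k%:R * cf_sgn M - p%:~R.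
Proof.
move=> ca; apply: (unimodular_gap (pr := (- 1) ^+ M * cf_p M.+1)
   (ps := (- 1) ^+ M * (cf_p M + c%:Z * cf_p M.+1))).
- exact: cf_qS_cf_sgn.
- exact: cf_q_add_cf_sgn.
- exact: cf_err_gt0.
- exact: cf_err_sub_gt0.
rewrite PoszD PoszM -[RHS](cf_det M) -[RHS]mul1r.
rewrite -[X in _ = X * _](_ : ((- 1) ^+ M) ^+ 2 = 1); first by ring.
exact: sqrr_sign.
Qed.

Lemma norm_cf_sgn M (k : nat) (p : int) :
  `|k%:R * cf_sgn M - ((- 1) ^+ M * p)%:~R| = `|k%:R * alpha - p%:~R|.
Proof.
rewrite (_ : _ - _ = (- 1) ^+ M * (k%:R * alpha - p%:~R)).
  by rewrite normrM normrX normrN1 expr1n mul1r.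
by rewrite /cf_sgn intrM rmorphXn /= rmorphN /=; ring.
Qed.

(** For [K = M.+1], [cf_gap] with [c = a_(M+1) - 1] covers exactly the indices below [cf_q M.+2],
    and its second error is [cf_err M.+1 + cf_err M.+2], larger than the first. *)
Lemma best_approx K (k : nat) (p : int) : (0 < k < cf_q K.+1)%N ->
  cf_err K <= `|k%:R * alpha - p%:~R|.
Proof.
case: K => [|M]; first by rewrite /=; lia.
have a0 := cf_quot_gt0 alpha01 alphaI M.
have ca : ((cf_quot alpha M.+1).-1 <= cf_quot alpha M.+1)%N := leq_pred _.
have aE : (cf_quot alpha M.+1).-1%:R = (cf_quot alpha M.+1)%:R - 1 :> R.
  by rewrite -[in RHS](prednK a0) -natr1 addrK.
move=> kq; rewrite -(norm_cf_sgn M) ler_normr.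
have := cf_gap ca ((- 1) ^+ M * p) (_ : _ < _ < _)%N.
rewrite (_ : (cf_q M.+1 + _)%N = cf_q M.+2).
  move=> /(_ k kq); rewrite aE.
  have -> : cf_err M - ((cf_quot alpha M.+1)%:R - 1) * cf_err M.+1 =
     cf_err M.+2 + cf_err M.+1 by rewrite cf_errSS; ring.
  have := cf_err_gt0 M.+2; set z := k%:R * _ - _.
  by move=> e0 [z1|z1]; apply/orP; [right|left]; lra.
by rewrite cf_qSS -[in RHS](prednK a0) mulSn; lia.
Qed.

Lemma cf_irr (j : nat) (p : int) : (0 < j)%N -> j%:R * alpha != p%:~R.
Proof.
move=> j0; have := @best_approx j.+1 j p; rewrite j0 andTb.
have jq : (j < cf_q j.+2)%N := cf_den_ge alpha01 alphaI j.+1.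
move=> /(_ jq) H; apply/eqP => E; rewrite E subrr normr0 in H.
by rewrite leNgt cf_err_gt0 in H.
Qed.

Lemma cf_sgn_irr M (j : nat) (p : int) : (0 < j)%N -> j%:R * cf_sgn M != p%:~R.
Proof.
move=> j0; rewrite /cf_sgn -signr_odd; case: (odd M); rewrite ?mul1r ?cf_irr//.
rewrite expr1 mulN1r mulrN; apply: contra (cf_irr (- p) j0) => /eqP E.
by rewrite rmorphN /= -E opprK.
Qed.

Lemma same_side_cf_sgn M m n : (0 < m <= n)%N ->
  same_side alpha m n <-> same_side (cf_sgn M) m n.
Proof.
move=> mn; rewrite /cf_sgn -signr_odd; case: (odd M); last by rewrite mul1r.
by rewrite expr1 mulN1r; apply: same_sideN => // j p; exact: cf_irr.
Qed.

Lemma balanced_iff_same_side (theta : R) m n : (0 < m <= n)%N ->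
  balanced_rectangles (sturmian alpha theta) m n <-> same_side alpha m n.
Proof.
(* The odd index [L] makes the error of the convergent positive, and [L > K] makes it smaller than
   the separation [cf_err K]. *)
move=> mn; pose K := (m + n)%N; pose L := K.*2.+1.
have LE : (cf_q L)%:R * alpha - (cf_p L)%:~R = cf_err L.
  have := cf_errE L; rewrite /L exprS -muln2 exprM sqrr_sign.
  by rewrite mulr1 mulN1r => /oppr_inj.
have errL k j : cf_err (k + j.+1) < cf_err k.
  elim: j => [|j IH]; first by rewrite addn1 cf_err_ltS.
  by rewrite addnS; apply: lt_trans (cf_err_ltS _) IH.
apply: (balanced_same_side cf_irr (d := cf_err K) theta mn _ _ LE).
- exact: cf_err_le1.
- move=> j p /andP[j0 jK]; apply: best_approx; rewrite j0 /=.
  by apply: leq_trans jK _; exact: cf_den_ge.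
- by rewrite cf_err_gt0 /L -addnn -addnS errL.
Qed.

End ContinuedFraction.

Arguments cf_q : simpl never.
Arguments cf_p : simpl never.
Arguments cf_err : simpl never.

(** * Approximation errors of Ostrowski tails *)

Section OstrowskiTails.
Local Open Scope ring_scope.
Variables (R : realType) (alpha : R).
Hypotheses (alpha01 : 0 < alpha < 1) (alphaI : irrational alpha).
Variables (b : nat -> nat) (K : nat).
Hypotheses (b_adm : ostrowski_adm alpha b).
Hypothesis b_zero : forall k, (K <= k)%N -> b k = 0%N.

Local Notation a := (cf_quot alpha).
Local Notation err := (cf_err alpha).

Definition ohead (L : nat) : nat := \sum_(0 <= k < L) b k * cf_den alpha k.

Definition otail (L : nat) : nat := \sum_(L <= k < K) b k * cf_den alpha k.

(* [otail L * (-1)^L alpha] modulo 1. *)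
Definition oerr (L : nat) : R :=
  (- 1) ^+ L * \sum_(L <= k < K) (- 1) ^+ k * (b k)%:R * err k.+1.

Lemma ohead_lt L : (ohead L < cf_q alpha L.+1)%N.
Proof. exact: ostrowski_sum_lt. Qed.

Lemma oheadS L : ohead L.+1 = (ohead L + b L * cf_den alpha L)%N.
Proof. by rewrite /ohead big_nat_recr. Qed.

Lemma ohead_eq0 L : ohead L = 0%N -> forall k, (k < L)%N -> b k = 0%N.
Proof.
elim: L => // L IH; rewrite oheadS => /eqP; rewrite addn_eq0 muln_eq0.
rewrite [cf_den alpha L == _]gtn_eqF ?(cf_den_gt0 alpha01)// orbF.
move=> /andP[/eqP h0 /eqP bL] k.
by rewrite ltnS leq_eqVlt => /orP[/eqP->//|]; exact: IH.
Qed.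

Lemma ohead_zero L : (forall k, (k < L)%N -> b k = 0%N) -> ohead L = 0%N.
Proof.
by move=> H; rewrite /ohead big_nat big1// => k kL; rewrite H.
Qed.

Lemma otailS L : otail L = (b L * cf_den alpha L + otail L.+1)%N.
Proof.
have [LK|KL] := ltnP L K; first by rewrite /otail big_ltn.
by rewrite /otail !big_geq ?b_zero// ltnW.
Qed.

Lemma ohead_otail L : (ohead L + otail L)%N = otail 0.
Proof.
by elim: L => [|L <-]; [rewrite /ohead big_geq|rewrite oheadS [otail L]otailS addnA].
Qed.

Lemma otail_zero L : (forall k, (L <= k)%N -> b k = 0%N) -> otail L = 0%N.
Proof.
move=> H; rewrite /otail big_nat big1// => k /andP[Lk _].
by rewrite H.
Qed.

Lemma oerr_geq L : (K <= L)%N -> oerr L = 0.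
Proof. by move=> KL; rewrite /oerr big_geq// mulr0. Qed.

Lemma oerrS L : oerr L = (b L)%:R * err L.+1 - oerr L.+1.
Proof.
have [LK|KL] := ltnP L K; last first.
  by rewrite !oerr_geq ?b_zero ?mul0r ?subr0// ltnW.
rewrite /oerr big_ltn// exprS mulrDr !mulrA -expr2 sqrr_sign; ring.
Qed.

Lemma otail_err L : exists p : int,
  (otail L)%:R * cf_sgn alpha L - p%:~R = oerr L.
Proof.
suff : forall j L, (K <= L + j)%N -> exists p : int,
    (otail L)%:R * cf_sgn alpha L - p%:~R = oerr L.
  by move=> /(_ K L); apply; exact: leq_addl.
elim=> [|j IH] {}L; rewrite ?addn0 => KL.
  by exists 0; rewrite /otail big_geq// oerr_geq// mul0r subr0.
have [p pE] := IH L.+1 ltac:(by rewrite addSnnS).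
exists ((b L)%:Z * ((- 1) ^+ L * cf_p alpha L.+1) - p).
rewrite otailS oerrS -pE -[err _](cf_qS_cf_sgn alpha L) rmorphB /= intrM -pmulrn.
have -> : cf_sgn alpha L.+1 = - cf_sgn alpha L by rewrite /cf_sgn exprS; ring.
by rewrite natrD natrM -[cf_q alpha L.+1]/(cf_den alpha L); ring.
Qed.

Lemma digit_le L : (b L <= a L.+1)%N.
Proof.
case: b_adm => b0 bk _; case: L => [|L]; last exact: bk.
by apply: leq_trans b0 _; exact: leq_subr.
Qed.

(** Downward induction through [oerrS]. The third bound uses the digit rule: [b_L > 0] excludes
    [b_(L+1) = a_(L+2)], so the second bound is available at [L + 1]. *)
Lemma oerr_bounds L :
  [/\ - err L.+1 < oerr L < err L,
      (b L < a L.+1)%N -> oerr L < err L - err L.+1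
    & (0 < b L)%N -> ((b L)%:R - 1) * err L.+1 + err L.+2 < oerr L].
Proof.
suff : forall j L, (K <= L + j)%N ->
  [/\ - err L.+1 < oerr L < err L,
      (b L < a L.+1)%N -> oerr L < err L - err L.+1
    & (0 < b L)%N -> ((b L)%:R - 1) * err L.+1 + err L.+2 < oerr L].
  by move=> /(_ K L); apply; lia.
elim=> [|j IH] {}L; rewrite ?addn0 => KL.
  have e0 := cf_err_gt0 alpha01 alphaI L.
  have e1 := cf_err_gt0 alpha01 alphaI L.+1.
  have e2 := cf_err_ltS alpha01 alphaI L.
  by rewrite oerr_geq// b_zero//; split=> // *; lra.
have [/andP[l1 l2] l3 _] := IH L.+1 ltac:(lia).
have e1 := cf_err_gt0 alpha01 alphaI L.+1.
have e2 := cf_err_gt0 alpha01 alphaI L.+2.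
have errE := cf_errSS alpha L.
have key : (0 < b L)%N -> oerr L.+1 < err L.+1 - err L.+2.
  move=> bL; apply: l3; rewrite ltn_neqAle digit_le andbT; apply/eqP => E.
  by case: b_adm => _ _ /(_ L.+1 isT E) /= bL0; rewrite bL0 in bL.
have bound (c d : nat) : (c <= d)%N -> c%:R * err L.+1 <= d%:R * err L.+1.
  by move=> bc; rewrite ler_pM2r// ler_nat.
have b0 : 0 <= (b L)%:R * err L.+1 by rewrite mulr_ge0// ltW.
rewrite oerrS; split.
- by have := bound _ _ (digit_le L); lra.
- by move=> /bound; rewrite -natr1; lra.
- by move=> /key; lra.
Qed.

(** At the lowest nonzero digit [oerr] is positive by the third bound, and each zero digit before it
    flips the sign. *)
Lemma oerr_gt0 L j : (forall k, (L <= k < L + j)%N -> b k = 0%N) ->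
  b (L + j) <> 0%N -> 0 < (- 1) ^+ j * oerr L.
Proof.
elim: j L => [|j IH] L bz bj.
  rewrite expr0 mul1r; rewrite addn0 in bj.
  have b1 : (0 < b L)%N by lia.
  have [_ _ /(_ b1)] := oerr_bounds L.
  have := cf_err_gt0 alpha01 alphaI L.+1.
  have := cf_err_gt0 alpha01 alphaI L.+2.
  have b1R : 1 <= (b L)%:R :> R by rewrite ler1n.
  have : 0 <= ((b L)%:R - 1) * err L.+1.
    by rewrite mulr_ge0 ?subr_ge0// ltW// cf_err_gt0.
  lra.
rewrite oerrS bz ?mul0r ?sub0r; last lia.
rewrite exprS mulN1r mulrNN; apply: IH => [k kL|]; first by apply: bz; lia.
by rewrite addSnnS.
Qed.

(** Turns the sign of [oerr L] into the parity of the run of zero digits, which the offsets [2 * t]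
    and [1 + 2 * t] in the shapes record. *)
Lemma oerr_trichotomy L :
  [\/ forall k, (L <= k)%N -> b k = 0%N,
      0 < oerr L /\ exists t, (forall k, (L <= k < L + 2 * t)%N -> b k = 0%N)
                        /\ b (L + 2 * t) <> 0%N
    | oerr L < 0 /\ exists t,
        (forall k, (L <= k < L + 1 + 2 * t)%N -> b k = 0%N)
          /\ b (L + 1 + 2 * t) <> 0%N].
Proof.
have [[j bj]|bz] := pselect (exists j, b (L + j) != 0%N); last first.
  constructor 1 => k Lk; apply/eqP/negPn/negP => bk; apply: bz.
  by exists (k - L)%N; rewrite subnKC.
have ex : exists j, b (L + j) != 0%N by exists j.
case: (ex_minnP ex) => {}j {}bj jmin.
have zero k : (L <= k < L + j)%N -> b k = 0%N.
  move=> kL; apply/eqP/negPn/negP => bk.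
  by have := jmin (k - L)%N; rewrite subnKC; [move=> /(_ bk)|]; lia.
have := oerr_gt0 zero (elimN eqP bj); rewrite -signr_odd.
have := odd_double_half j; case: (odd j) => jE; rewrite -jE in zero bj *.
  rewrite expr1 mulN1r oppr_gt0 => e0; constructor 3; split=> //.
  exists j./2; split=> [k kL|]; first by apply: zero; rewrite -muln2; lia.
  by rewrite -addnA mul2n; exact/eqP.
rewrite expr0 mul1r => e0; constructor 2; split=> //.
exists j./2; split=> [k kL|]; first by apply: zero; rewrite -muln2; lia.
by rewrite mul2n; exact/eqP.
Qed.

End OstrowskiTails.

(** * The four shapes and the same-side condition *)

Section Shapes.
Local Open Scope ring_scope.
Variables (R : realType) (alpha : R).
Hypotheses (alpha01 : 0 < alpha < 1) (alphaI : irrational alpha).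

Local Notation a := (cf_quot alpha).
Local Notation q := (cf_q alpha).
Local Notation err := (cf_err alpha).
Local Notation digit := (ostrowski_digit alpha).
Local Notation err_gt0 := (cf_err_gt0 alpha01 alphaI).
Local Notation err_ltS := (cf_err_ltS alpha01 alphaI).

Lemma err_le i j : (i <= j)%N -> err j <= err i.
Proof.
elim: j => [|j IH]; first by rewrite leqn0 => /eqP->.
rewrite leq_eqVlt => /orP[/eqP->//|]; rewrite ltnS => /IH.
by apply: le_trans; apply: ltW; exact: err_ltS.
Qed.

Lemma digit_adm n : ostrowski_adm alpha (digit n).
Proof. by case: (ostrowski_digitP alpha01 alphaI n) => _ d0 dk dE; split. Qed.

Lemma digit_tail n : exists K,
  (forall k, (K <= k)%N -> digit n k = 0%N) /\ otail alpha (digit n) K 0 = n.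
Proof.
by case: (ostrowski_digitP alpha01 alphaI n) => -[N [dz nE]] _ _ _; exists N.+1.
Qed.

Lemma lt_cf_q m M : (forall k, (M < k)%N -> digit m k = 0%N) ->
  (m < q M.+2)%N.
Proof.
move=> dz; have [K [Kz mE]] := digit_tail m.
rewrite -{1}mE -(ohead_otail alpha Kz M.+1) (otail_zero alpha K dz) addn0.
exact: (ohead_lt alpha01 alphaI (digit_adm m)).
Qed.

Lemma top_digit m : (0 < m)%N -> exists M,
  [/\ forall k, (M < k)%N -> digit m k = 0%N, digit m M <> 0%N
    & (q M.+1 <= m < q M.+2)%N].
Proof.
move=> m0; have [K [Kz mE]] := digit_tail m.
have ex : exists k, digit m k != 0%N.
  apply: contrapT => H; have : otail alpha (digit m) K 0 = 0%N.
    apply: otail_zero => k _; apply/eqP/negPn/negP => dk; apply: H.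
    by exists k.
  by rewrite mE => m00; rewrite m00 in m0.
have bd k : digit m k != 0%N -> (k <= K)%N.
  by rewrite leqNgt; apply: contra => Kk; rewrite Kz// ltnW.
case: (ex_maxnP ex bd) => M dM Mmax.
have dz k : (M < k)%N -> digit m k = 0%N.
  move=> Mk; apply/eqP/negPn/negP => dk.
  by have := Mmax k dk; rewrite leqNgt Mk.
exists M; split=> //; first exact/eqP.
rewrite (lt_cf_q dz) andbT -{1}mE -(ohead_otail alpha Kz M) (otailS alpha Kz).
apply: leq_trans (leq_addl _ _); apply: leq_trans (leq_addr _ _).
by rewrite leq_pmull// lt0n.
Qed.

Lemma near_same_side m n M (p : int) :
  (m < q M.+2)%N -> `|n%:R * alpha - p%:~R| < err M.+1 -> same_side alpha m n.
Proof.
move=> mq; apply: same_side_close => k p' /andP[k0 km].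
apply: (best_approx alpha01 alphaI); rewrite k0; exact: ltn_trans km mq.
Qed.

Lemma norm_sgn_alpha M (x : nat) (p : int) : exists p' : int,
  `|x%:R * cf_sgn alpha M - p%:~R| = `|x%:R * alpha - p'%:~R|.
Proof.
exists ((- 1) ^+ M * p); rewrite -(norm_cf_sgn alpha M) mulrA -expr2.
by rewrite sqrr_sign mul1r.
Qed.

Lemma shape_i_same_side m n : shape_i alpha m n -> same_side alpha m n.
Proof.
move=> [M [mz nz]]; have [K [Kz nE]] := digit_tail n.
have [p pE] := otail_err alpha Kz M.+1.
have [p' p'E] := norm_sgn_alpha M.+1 (otail alpha (digit n) K M.+1) p.
apply: (@near_same_side _ _ M p' (lt_cf_q mz)).
have tE : otail alpha (digit n) K M.+1 = n.
  by rewrite -[RHS]nE -(ohead_otail alpha Kz M.+1) ohead_zero.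
rewrite tE in pE p'E.
rewrite -p'E pE ltr_norml.
have [] := oerr_bounds alpha01 alphaI (digit_adm n) Kz M.+1.
have := err_ltS M.+1; lra.
Qed.

(** Here [oerr M = err M.+1 - oerr M.+1], and the even run of zero digits gives
    [0 < oerr M.+1 < err M.+1]. *)
Lemma shape_ii_same_side m n : shape_ii alpha m n -> same_side alpha m n.
Proof.
move=> [M [t [mz _ nM nz nt]]]; have [K [Kz nE]] := digit_tail n.
have [p pE] := otail_err alpha Kz M.
have [p' p'E] := norm_sgn_alpha M (otail alpha (digit n) K M) p.
apply: (@near_same_side _ _ M p' (lt_cf_q mz)).
have tE : otail alpha (digit n) K M = n.
  rewrite -[RHS]nE -(ohead_otail alpha Kz M) ohead_zero// => k kM.
  by apply: nz; left.
rewrite tE in pE p'E.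
rewrite -p'E pE ltr_norml (oerrS alpha Kz) nM mul1r.
have [e1 _ _] := oerr_bounds alpha01 alphaI (digit_adm n) Kz M.+1.
have e2 : 0 < (- 1) ^+ (2 * t) * oerr alpha (digit n) K M.+1.
  apply: (oerr_gt0 alpha01 alphaI (digit_adm n) Kz) => [k kM|].
    by apply: nz; right; lia.
  by rewrite -[M.+1]addn1.
rewrite exprM sqrrN expr1n expr1n mul1r in e2.
lra.
Qed.

(** * The case of two gap lengths *)

Section TwoGaps.
Variables (M c n : nat).
Hypotheses (ca : (c < a M.+1)%N) (s0 : (0 < q M + c * q M.+1)%N).
Hypothesis mn : (q M.+1 + (q M + c * q M.+1) <= n)%N.

Lemma gap_lt : err M.+1 < err M - c%:R * err M.+1.
Proof.
have := err_gt0 M.+2; rewrite cf_errSS.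
have : c.+1%:R * err M.+1 <= (a M.+1)%:R * err M.+1.
  by rewrite ler_pM2r ?err_gt0// ler_nat.
by rewrite -natr1; lra.
Qed.

Lemma two_gaps : same_side alpha (q M.+1 + (q M + c * q M.+1)) n <->
  forall (k : nat) (p : int), (0 < k < q M.+1 + (q M + c * q M.+1))%N ->
    ~ (0 < (n%:R - k%:R) * cf_sgn alpha M - p%:~R <
         err M - c%:R * err M.+1 - err M.+1).
Proof.
have r0 := cf_q_gt0 alpha01 alphaI M.
rewrite (same_side_cf_sgn alpha01 alphaI M); last by rewrite addn_gt0 r0.
apply: (same_side_two_gaps (pr := (- 1) ^+ M * cf_p alpha M.+1)
   (ps := (- 1) ^+ M * (cf_p alpha M + c%:Z * cf_p alpha M.+1))) => //.
- by move=> j p; exact: cf_sgn_irr.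
- exact: cf_qS_cf_sgn.
- exact: cf_q_add_cf_sgn.
- exact: (cf_gap alpha01 alphaI (ltnW ca)).
- exact: err_gt0.
- exact: (cf_err_sub_gt0 alpha01 alphaI (ltnW ca)).
- exact: gap_lt.
Qed.

(** Applied to the head [n0] and tail [n1] of [n]. For [k < n0] the distance hypothesis at [n0 - k]
    keeps [(n - k) alpha] out of the forbidden arc, for [k > n0] the gap at [k - n0] does, and for
    [k = n0] the point is [- z], on the wrong side of 0. *)
Lemma two_gaps_same_side n0 n1 (p1 : int) (z : R) : n = (n0 + n1)%N ->
  n1%:R * cf_sgn alpha M - p1%:~R = - z -> 0 < z < err M.+1 ->
  (forall (j : nat) (p : int), (0 < j < n0)%N ->
    err M - c%:R * err M.+1 - err M.+1 + z <= `|j%:R * alpha - p%:~R|) ->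
  same_side alpha (q M.+1 + (q M + c * q M.+1)) n.
Proof.
move=> nE n1E z0 far; apply/two_gaps => k p km.
have -> : (n%:R - k%:R) * cf_sgn alpha M - p%:~R =
    (n0%:R - k%:R) * cf_sgn alpha M - (p - p1)%:~R - z.
  by rewrite nE natrD rmorphB /= -[in RHS]n1E; ring.
have [kn|nk|->] := ltngtP k n0.
- have [p' p'E] := norm_sgn_alpha M (n0 - k)%N (p - p1).
  have := far (n0 - k)%N p' ltac:(clear -kn km; lia).
  rewrite -p'E natrB 1?ltnW// => + H.
  by rewrite ger0_norm; lra.
- have := cf_gap alpha01 alphaI (ltnW ca) (- (p - p1)) (_ : 0 < k - n0 < _)%N.
  move=> /(_ ltac:(clear -nk km; lia)).
  rewrite rmorphN /= natrB 1?ltnW//.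
  have -> : (k%:R - n0%:R) * cf_sgn alpha M - - (p - p1)%:~R =
     - ((n0%:R - k%:R) * cf_sgn alpha M - (p - p1)%:~R) by ring.
  move: (_ - (p - p1)%:~R : R) => w; have := err_gt0 M.+1.
  by move=> e0 [] g H; clear nE; lra.
rewrite subrr mul0r sub0r => H.
have e1 := cf_err_le1 alpha01 alphaI M.
have e2 : 0 <= c%:R * err M.+1 by rewrite mulr_ge0// ltW// err_gt0.
have p0 : p - p1 = 0 by apply: (@int_eq0 R); lra.
by rewrite p0 in H; clear nE p0; lra.
Qed.

End TwoGaps.

(** * Ostrowski representations occurring in shapes iii and iv *)

Lemma sum_delta (f : nat -> nat) N M : (M < N)%N ->
  (\sum_(0 <= k < N) (if k == M then f k else 0) = f M)%N.
Proof.
move=> MN; rewrite -big_mkcond /= big_mkord.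
by rewrite (big_pred1 (Ordinal MN)).
Qed.

Lemma rep_delta m M :
  ostrowski_rep alpha m (fun k => if k == M then 1 else 0)%N -> m = q M.+1.
Proof.
case=> -[N [Nz ->]] _ _ _.
have MN : (M < N.+1)%N.
  by rewrite ltnS leqNgt; apply/negP => /Nz; rewrite eqxx.
rewrite -[RHS](sum_delta (cf_den alpha) MN); apply: eq_bigr => k _.
by case: eqP => _; rewrite ?mul1n ?mul0n.
Qed.

Lemma rep_delta2 m M c : (0 < M)%N -> (0 < c)%N ->
  ostrowski_rep alpha m
    (fun k => if k == M.-1 then 1 else if k == M then c else 0)%N ->
  m = (q M + c * q M.+1)%N.
Proof.
case: M => // M _ c0 [[N [Nz ->]] _ _ _] /=.
have MN : (M.+1 < N.+1)%N.
  rewrite ltnS leqNgt; apply/negP => /Nz; rewrite eqxx.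
  by rewrite /= (gtn_eqF (ltnSn M)); lia.
rewrite -[q M.+1]/(cf_den alpha M) -[q M.+2]/(cf_den alpha M.+1).
rewrite -(sum_delta (cf_den alpha) (ltnW MN)).
rewrite -(sum_delta (fun k => c * cf_den alpha k)%N MN) -big_split /=.
apply: eq_bigr => k _; have [->|kM] := eqVneq k M.
  by rewrite (ltn_eqF (ltnSn M)) mul1n addn0.
by case: eqP => _; rewrite ?mul0n ?add0n.
Qed.

Lemma delta_rep M : (0 < M)%N ->
  ostrowski_rep alpha (q M.+1) (fun k => if k == M then 1 else 0)%N.
Proof.
move=> M0; split.
- exists M; split=> [k Mk|]; first by rewrite gtn_eqF.
  rewrite -[LHS](sum_delta (cf_den alpha) (ltnSn M)); apply: eq_bigr => k _.
  by case: eqP => _; rewrite ?mul1n ?mul0n.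
- by rewrite ltn_eqF.
- by move=> k k0; case: eqP => // _; exact: cf_quot_gt0.
- move=> k k0; have := cf_quot_gt0 alpha01 alphaI k.
  by case: eqP => [->|_] A E; [rewrite ltn_eqF// prednK|rewrite -E in A].
Qed.

(** For [M = 1] the lower digit is [b_0 = 1], which is admissible only if [a_1 > 1]. *)
Lemma delta2_rep M c : (0 < M)%N -> (0 < c < a M.+1)%N ->
  (M = 1%N -> 1 < a 1)%N ->
  ostrowski_rep alpha (q M + c * q M.+1)
    (fun k => if k == M.-1 then 1 else if k == M then c else 0)%N.
Proof.
case: M => // M _ /andP[c0 ca] M1; split.
- exists M.+1; split=> [k Mk|] /=; first by do 2![case: eqP => [kM|_]; first by lia].
  rewrite -[q M.+1]/(cf_den alpha M) -[q M.+2]/(cf_den alpha M.+1).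
  rewrite -(sum_delta (cf_den alpha) (ltnW (ltnSn M.+1))).
  rewrite -(sum_delta (fun k => c * cf_den alpha k)%N (ltnSn M.+1)).
  rewrite -big_split /=; apply: eq_bigr => k _; have [->|kM] := eqVneq k M.
    by rewrite (ltn_eqF (ltnSn M)) mul1n addn0.
  by case: eqP => _; rewrite ?mul0n ?add0n.
- case: M ca M1 => [|M] ca M1 //.
  by have := M1 erefl; rewrite -subn_gt0.
- move=> k k0 /=; case: eqP => _; first exact: cf_quot_gt0.
  by case: eqP => [->|_//]; exact: ltnW.
- move=> k k0; have := cf_quot_gt0 alpha01 alphaI k.
  rewrite /=; case: eqP => [kM|_] A.
    by move=> _; do 2![case: eqP => [kM'|_]; first by lia].
  case: eqP => [kM E|_ E]; last by rewrite -E in A.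
  by move: ca; rewrite E kM ltnn.
Qed.

(** [q_M] is the sum of the neighbour indices [q_(M-1)] and [q_(M-2) + (a_M - 1) q_(M-1)], so the
    two-gap criterion applies; [z] is the error of the tail of [n] from [M], positive by parity. *)
Lemma shape_iii_same_side m n : (1 < m <= n)%N ->
  shape_iii alpha m n -> same_side alpha m n.
Proof.
move=> /andP[m1 mn] [M [t [/rep_delta mE nz nt]]].
have [K [Kz nE]] := digit_tail n; have adm := digit_adm n.
case: M mE nz nt => [mE|M mE nz nt]; first by rewrite mE in m1.
have a0 := cf_quot_gt0 alpha01 alphaI M.
have mE' : m = (q M.+1 + (q M + (a M.+1).-1 * q M.+1))%N.
  by rewrite mE cf_qSS -[in LHS](prednK a0) mulSn; clear; lia.
have cE : (a M.+1).-1%:R = (a M.+1)%:R - 1 :> R.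
  by rewrite -[in RHS](prednK a0) -natr1 addrK.
rewrite mE'; rewrite mE' in mn m1.
have [p pE] := otail_err alpha Kz M.+1.
have e0 : 0 < (- 1) ^+ (2 * t) * oerr alpha (digit n) K M.+1.
  exact: (oerr_gt0 alpha01 alphaI adm Kz).
rewrite exprM sqrrN expr1n expr1n mul1r in e0.
have [/andP[_ e1] e2 _] := oerr_bounds alpha01 alphaI adm Kz M.+1.
apply: (@two_gaps_same_side M (a M.+1).-1 n _ _ _ (ohead alpha (digit n) M.+1)
   (otail alpha (digit n) K M.+1) (- p) (oerr alpha (digit n) K M.+1)) => //.
- by rewrite prednK.
- have : (q M.+1 <= 1)%N || (0 < q M)%N.
    by case: (M) => [|M'] //; rewrite cf_q_gt0 ?orbT.
  move: m1; move: (q M) (q M.+1) (_ * _)%N => x y z m1 /orP[]; clear -m1; lia.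
- by rewrite (ohead_otail alpha Kz).
- by rewrite -pE /cf_sgn exprS rmorphN /=; ring.
- by rewrite e0.
move=> j p' /andP[j0 jh]; rewrite cE.
have -> : err M - ((a M.+1)%:R - 1) * err M.+1 - err M.+1 = err M.+2.
  by rewrite cf_errSS; ring.
(* Below its maximum this digit leaves room between [oerr] and [err M.+1]; at its maximum the
   preceding digit vanishes, so the head is below [q M.+1] and the larger bound [err M] applies. *)
have [ba|ba] := ltnP (digit n M.+1) (a M.+2).
  have : err M.+1 <= `|j%:R * alpha - p'%:~R|.
    apply: (best_approx alpha01 alphaI); rewrite j0.
    exact: ltn_trans jh (ohead_lt alpha01 alphaI adm _).
  by have := e2 ba; lra.
have bE : digit n M.+1 = a M.+2.
  by apply/eqP; rewrite eqn_leq ba (digit_le adm).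
have b0 : digit n M = 0%N by case: adm => _ _ /(_ M.+1 isT bE).
have : err M <= `|j%:R * alpha - p'%:~R|.
  apply: (best_approx alpha01 alphaI); rewrite j0.
  apply: ltn_trans jh _; rewrite oheadS b0 mul0n addn0.
  exact: (ohead_lt alpha01 alphaI adm _).
have : 1 * err M.+1 <= (a M.+1)%:R * err M.+1.
  by rewrite ler_pM2r ?err_gt0// ler1n.
by rewrite cf_errSS; lra.
Qed.

(** Two gaps with [c = a - 1]. Digit [M] of [n] vanishes, so the head is below [q M.+1] and smaller
    indices keep distance [err M], more than the arc length plus [z]. *)
Lemma shape_iv_same_side m n : (m <= n)%N ->
  shape_iv alpha m n -> same_side alpha m n.
Proof.
move=> mn [M [c [t [M0 /andP[c0 ca] /(rep_delta2 M0 c0) mE nz nt]]]].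
have [K [Kz nE]] := digit_tail n; have adm := digit_adm n.
case: c c0 ca mE => // c _ ca mE.
have mE' : m = (q M.+1 + (q M + c * q M.+1))%N.
  by rewrite mE mulSn; clear; lia.
rewrite mE'; rewrite mE' in mn.
have [p pE] := otail_err alpha Kz M.+1.
have e0 : 0 < (- 1) ^+ (2 * t) * oerr alpha (digit n) K M.+1.
  apply: (oerr_gt0 alpha01 alphaI adm Kz) => [k kM|].
    by apply: nz; clear -kM; lia.
  by rewrite -[M.+1]addn1.
rewrite exprM sqrrN expr1n expr1n mul1r in e0.
have [/andP[_ e1] _ _] := oerr_bounds alpha01 alphaI adm Kz M.+1.
apply: (@two_gaps_same_side M c n _ _ _ (ohead alpha (digit n) M.+1)
   (otail alpha (digit n) K M.+1) (- p) (oerr alpha (digit n) K M.+1)) => //.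
- exact: ltnW.
- by case: (M) M0 => // M' _; rewrite addn_gt0 cf_q_gt0.
- by rewrite (ohead_otail alpha Kz).
- by rewrite -pE /cf_sgn exprS rmorphN /=; ring.
- by rewrite e0.
move=> j p' /andP[j0 jh].
have nM : digit n M = 0%N by apply: nz; clear; lia.
have : err M <= `|j%:R * alpha - p'%:~R|.
  apply: (best_approx alpha01 alphaI); rewrite j0.
  apply: ltn_trans jh _; rewrite oheadS nM mul0n addn0.
  exact: (ohead_lt alpha01 alphaI adm _).
have : 0 <= c%:R * err M.+1 by rewrite mulr_ge0// ltW// err_gt0.
lra.
Qed.

(** Let [l] be the position of the lowest nonzero digit of [n]. If [l <= M], the lower bound on
    [oerr l] forces [l = M] with digit 1, and [oerr M < err M.+1] makes [oerr M.+1] positive, which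
    is the parity in shape ii. *)
Lemma near_shapes m n M (p : int) :
  (forall k, (M < k)%N -> digit m k = 0%N) -> digit m M <> 0%N ->
  `|n%:R * alpha - p%:~R| < err M.+1 ->
  shape_i alpha m n \/ shape_ii alpha m n.
Proof.
move=> mz mM near; have [K [Kz nE]] := digit_tail n.
have adm := digit_adm n.
have [[l0 l0n]|nz] := pselect (exists l, digit n l != 0%N); last first.
  left; exists M; split=> // k _; apply/eqP/negPn/negP => dk; apply: nz.
  by exists k.
case: (ex_minnP (ex_intro (fun l => digit n l != 0%N) _ l0n)) => l ln lmin.
have low k : (k < l)%N -> digit n k = 0%N.
  by move=> kl; apply/eqP/negPn/negP => /lmin; rewrite leqNgt kl.
have [Ml|lM] := ltnP M l.
  by left; exists M; split=> // k kM; apply: low; exact: leq_ltn_trans Ml.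
have [p1 p1E] := otail_err alpha Kz l.
have tE : otail alpha (digit n) K l = n.
  by rewrite -[RHS]nE -(ohead_otail alpha Kz l) ohead_zero.
rewrite tE in p1E.
have [/andP[_ e1] e2 e3] := oerr_bounds alpha01 alphaI adm Kz l.
have b1 : (0 < digit n l)%N by rewrite lt0n.
have {}e3 := e3 b1.
have b1R : 1 <= (digit n l)%:R :> R by rewrite ler1n.
have e4 : 0 <= ((digit n l)%:R - 1) * err l.+1.
  by rewrite mulr_ge0 ?subr_ge0// ltW// err_gt0.
have e5 := err_gt0 l.+2; have e6 := err_gt0 M.+1.
(* The distance of [n alpha] to the nearest integer is [oerr l]: any other
   integer is at distance more than [err M.+1]. *)
have small : oerr alpha (digit n) K l + err M.+1 < 1.
  case: (l) lM e1 e2 => [|l'] lM e1 e2.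
    have : (digit n 0 < a 1)%N.
      have a1 := cf_quot_gt0 alpha01 alphaI 0.
      by case: adm => + _ _ => h; move: h a1; clear; lia.
    move=> /e2; have := err_le (ltn0Sn M).
    by rewrite -[err 0]/(1 : R); lra.
  have l1 := err_le (ltn0Sn l').
  have M1 := err_le (leq_ltn_trans (leq0n l') lM : (1 < M.+1)%N).
  have : 1 * err 1 <= (a 1)%:R * err 1.
    by rewrite ler_pM2r ?err_gt0// ler1n; exact: cf_quot_gt0.
  by move: M1; rewrite (cf_errSS _ 0) -[err 0]/(1 : R); lra.
have e7 : oerr alpha (digit n) K l < err M.+1.
  move: near; rewrite -(norm_cf_sgn alpha l) ltr_norml.
  set P := (_ * p) => near.
  have P0 : P - p1 = 0 by apply: (@int_eq0 R); rewrite rmorphB /=; lra.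
  have PE : P%:~R = p1%:~R :> R by congr _%:~R; move: P0; clear; lia.
  by rewrite PE p1E in near; case/andP: near.
have lM' : l = M.
  apply/eqP; rewrite eqn_leq lM leqNgt; apply/negP => lM'.
  by have := err_le (lM' : (l.+2 <= M.+1)%N); lra.
rewrite lM' in low e3 e4 e7 b1 b1R *.
have bM : digit n M = 1%N.
  apply/eqP; rewrite eqn_leq b1 andbT leqNgt; apply/negP => b2.
  have : 1 * err M.+1 <= ((digit n M)%:R - 1) * err M.+1.
    by rewrite ler_pM2r// lerBrDr -[1 + 1]/(2%:R) ler_nat.
  by have := err_gt0 M.+2; lra.
right; exists M; rewrite (oerrS alpha Kz) bM mul1r in e7.
have [z|[_ [t [tz tn]]]|[e8 _]] := oerr_trichotomy alpha01 alphaI adm Kz M.+1.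
- suff e0 : oerr alpha (digit n) K M.+1 = 0 by exfalso; move: e7; lra.
  rewrite /oerr big_nat big1 ?mulr0// => k /andP[Mk _].
  by rewrite z// mulr0 mul0r.
- exists t; split=> //; last by rewrite addn1.
  move=> k [kM|kM]; first exact: low.
  by apply: tz; move: kM; clear; lia.
- by exfalso; move: e7; lra.
Qed.

(** A zero tail from [M] would give [n < m], and a positive error is shape iii. A negative one is
    shape i if the head of [n] is 0; otherwise the head is a [k] violating the two-gap criterion. *)
Lemma avoid_shapes_q m n M : (1 < m <= n)%N -> m = q M.+1 ->
  (forall k, (M < k)%N -> digit m k = 0%N) ->
  same_side alpha m n -> shape_i alpha m n \/ shape_iii alpha m n.
Proof.
move=> /andP[m1 mn] mE mz ss.
have [K [Kz nE]] := digit_tail n.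
have adm := digit_adm n.
have hlt := ohead_lt alpha01 alphaI adm M.
have hE := ohead_otail alpha Kz M; rewrite nE in hE.
have [z|[_ [t [tz tn]]]|[e0 [t [tz _]]]] :=
  oerr_trichotomy alpha01 alphaI adm Kz M.
- exfalso; move: hE hlt; rewrite (otail_zero alpha K z) -mE; move: mn; clear.
  by rewrite addn0 => + -> => h1 h2; move: (leq_trans h2 h1); rewrite ltnn.
- right; exists M, t; split=> //; rewrite mE; apply: delta_rep.
  by case: (M) mE => // mE; rewrite mE in m1.
have bM : digit n M = 0%N by apply: tz; clear; lia.
have [h0|h0] := posnP (ohead alpha (digit n) M).
  left; exists M; split=> // k; rewrite leq_eqVlt => /orP[/eqP->//|].
  exact: (ohead_eq0 alpha01 alphaI h0).
exfalso.
case: M mE mz hlt hE e0 tz bM h0 => [mE|M mE mz hlt hE e0 tz bM h0].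
  by rewrite mE in m1.
have a0 := cf_quot_gt0 alpha01 alphaI M.
have mE' : m = (q M.+1 + (q M + (a M.+1).-1 * q M.+1))%N.
  by rewrite mE cf_qSS -[in LHS](prednK a0) mulSn; clear; lia.
have cE : (a M.+1).-1%:R = (a M.+1)%:R - 1 :> R.
  by rewrite -[in RHS](prednK a0) -natr1 addrK.
have s0 : (0 < q M + (a M.+1).-1 * q M.+1)%N.
  have : (q M.+1 <= 1)%N || (0 < q M)%N.
    by case: (M) => [|M'] //; rewrite cf_q_gt0 ?orbT.
  rewrite mE' in m1.
  move: m1; move: (q M) (q M.+1) (_ * _)%N => x y z m1 /orP[]; clear -m1; lia.
rewrite mE' in ss mn; rewrite -mE mE' in hlt.
have ca : ((a M.+1).-1 < a M.+1)%N by rewrite prednK.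
have /(_ _) av := proj1 (two_gaps ca s0 mn) ss.
have [p pE] := otail_err alpha Kz M.+1.
apply: (av (ohead alpha (digit n) M.+1) (- p)); first by rewrite h0.
rewrite (_ : (_ - _) * _ - _ = - oerr alpha (digit n) K M.+1); last first.
  have nR : n%:R = (ohead alpha (digit n) M.+1)%:R +
    (otail alpha (digit n) K M.+1)%:R :> R by rewrite -natrD hE.
  by rewrite -pE nR /cf_sgn exprS rmorphN /=; ring.
rewrite cE.
have -> : err M - ((a M.+1)%:R - 1) * err M.+1 - err M.+1 = err M.+2.
  by rewrite cf_errSS; ring.
have [+ _ _] := oerr_bounds alpha01 alphaI adm Kz M.+1.
by lra.
Qed.

Lemma avoid_shapes m n M c : (1 < m <= n)%N ->
  m = (q M.+1 + (q M + c * q M.+1))%N -> (c.+1 < a M.+1)%N ->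
  (q M.+1 < m)%N ->
  (forall k, (M < k)%N -> digit m k = 0%N) -> digit m M <> 0%N ->
  same_side alpha m n ->
  [\/ shape_i alpha m n, shape_ii alpha m n | shape_iv alpha m n].
Proof.
move=> /andP[m1 mn] mE ca qm mz mM ss.
have [K [Kz nE]] := digit_tail n.
have adm := digit_adm n.
have hlt := ohead_lt alpha01 alphaI adm M.
have hE := ohead_otail alpha Kz M.
rewrite nE (otailS alpha Kz) -[cf_den alpha M]/(q M.+1) in hE.
have [/andP[e1 e2] _ _] := oerr_bounds alpha01 alphaI adm Kz M.+1.
have [p pE] := otail_err alpha Kz M.+1.
set h := ohead _ _ _ in hlt hE; set b := digit n M in hE.
set n1 := otail _ _ _ _ in hE pE; set e := oerr _ _ _ _ in e1 e2 pE.
have E1 := err_gt0 M.+1; have E2 := err_gt0 M.+2; have EE := cf_errSS alpha M.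
have s0 : (0 < q M + c * q M.+1)%N.
  by move: qm; rewrite mE -[X in (X < _)%N]addn0 ltn_add2l.
(* The choice [k = h + (b - b') q_M] leaves [b'] copies of [q_M] and the tail in [n - k], at
   position [b' err M.+1 - e], which must not fall in the forbidden arc. *)
have viol b' : (b' <= b)%N -> (0 < h + (b - b') * q M.+1 < m)%N ->
    0 < b'%:R * err M.+1 - e ->
    b'%:R * err M.+1 - e < err M - c%:R * err M.+1 - err M.+1 -> False.
  move=> b'b hm g1 g2; move: (ss) (mn); rewrite mE => ss' mn'.
  have av := proj1 (two_gaps (ltnW ca) s0 mn') ss'.
  rewrite mE in hm.
  apply: (av _ (b'%:Z * ((- 1) ^+ M * cf_p alpha M.+1) - p) hm).
  rewrite (_ : (_ - _) * _ - _ = b'%:R * err M.+1 - e); first by rewrite g1.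
  rewrite -pE -[in RHS](cf_qS_cf_sgn alpha M) rmorphB /= intrM -pmulrn.
  have -> : cf_sgn alpha M.+1 = - cf_sgn alpha M by rewrite /cf_sgn exprS; ring.
  have nR : n%:R = h%:R + (b%:R * (q M.+1)%:R + n1%:R) :> R.
    by rewrite -natrM -!natrD hE.
  by rewrite nR natrD natrM natrB//; ring.
have cbound (c' : nat) : (c' + c.+1 <= a M.+1)%N ->
    c'%:R * err M.+1 + err M.+2 <= err M - c%:R * err M.+1 - err M.+1.
  move=> c'a; have : (c' + c.+1)%:R * err M.+1 <= (a M.+1)%:R * err M.+1.
    by rewrite ler_pM2r// ler_nat.
  by rewrite natrD -[c.+1%:R]natr1 EE; lra.
have pos (b' : nat) : (0 < b')%N -> err M.+1 <= b'%:R * err M.+1.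
  by move=> b0; rewrite -[X in X <= _]mul1r ler_pM2r// ler1n.
have qM0 := cf_q_gt0 alpha01 alphaI M.
have bM0 : M = 0%N -> (b < a 1)%N.
  move=> M0; have a1 := cf_quot_gt0 alpha01 alphaI 0; rewrite /b M0.
  by case: adm => + _ _ => h0; move: h0 a1; clear; lia.
have ba : (b <= a M.+1)%N := digit_le adm M.
have [b0|b0] := posnP b.
  have [h0|h0] := posnP h.
    constructor 1; exists M; split=> // k.
    rewrite leq_eqVlt => /orP[/eqP->//|]; exact: (ohead_eq0 alpha01 alphaI h0).
  have [z|[e0 _]|[e0 [t [tz tn]]]] := oerr_trichotomy alpha01 alphaI adm Kz M.
  - exfalso; have z1 : n1 = 0%N by apply: otail_zero => k Mk; apply: z; exact: ltnW.
    move: hE; rewrite b0 z1 mul0n !addn0 => hE.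
    have nq : (n < q M.+1)%N by move: hlt; rewrite hE.
    by move: (leq_ltn_trans mn nq); rewrite ltnNge ltnW.
  - exfalso; rewrite (oerrS alpha Kz) -/b -/e b0 mul0r sub0r in e0.
    apply: (viol 0%N); rewrite ?b0 ?mul0n ?addn0 ?mul0r ?sub0r//.
      by rewrite h0; exact: ltn_trans hlt qm.
    have := cbound 0%N (ltnW ca); lra.
  have M0 : (0 < M)%N.
    by rewrite lt0n; apply/eqP => M0; move: h0; rewrite /h M0 /ohead big_geq.
  constructor 3; exists M, c.+1, t; split=> //.
  rewrite (_ : m = q M + c.+1 * q M.+1)%N; last by rewrite mE mulSn addnCA.
  apply: delta2_rep => // M1.
  move: h0; rewrite /h M1 oheadS /ohead big_geq// add0n muln1.
  by case: adm => + _ _ => h0 h1; move: h0 h1; clear; lia.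
have mulq (x y : nat) : (x <= y)%N -> (x * q M.+1 <= y * q M.+1)%N.
  by move=> xy; rewrite leq_mul2r xy orbT.
have [h0|h0] := posnP h.
  have [b2|b2] := ltnP 1 b.
    (* As [h = 0], [b' <= b - 1] keeps [k] positive; the other bound keeps the point inside the
       arc. *)
    exfalso; pose b' := minn b.-1 (a M.+1 - c.+1).
    have b'1 : (0 < b')%N by move: b2 ca; rewrite /b'; clear; lia.
    have b'2 : (b' + c.+1 <= a M.+1)%N by move: b2 ca; rewrite /b'; clear; lia.
    apply: (viol b').
    - by move: b2; rewrite /b'; clear; lia.
    - rewrite h0 add0n muln_gt0 qM0 andbT; apply/andP; split.
        by move: b2; rewrite /b'; clear; lia.
      rewrite mE addnCA -mulSn.
      (* For [M = 0] the summand [q M] is 0, and [k < m] rests on the stricter digit bound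
         [b_0 < a_1]. *)
      case: (posnP M) => [M0|M0].
        have ca' : (c > 0)%N.
          by move: m1; rewrite mE M0 -[q 0]/0%N -[q 1]/1%N; clear; lia.
        apply: leq_trans (leq_addl _ _); rewrite ltn_pmul2r//.
        by have := bM0 M0; move: ca b2 ca' ba; rewrite /b' M0; clear; lia.
      apply: (@leq_ltn_trans (c.+1 * q M.+1)).
        by apply: mulq; move: ca b2 ba; rewrite /b'; clear; lia.
      rewrite -[X in (X < _)%N]add0n ltn_add2r.
      by case: (M) M0 => // M' _; exact: cf_q_gt0.
    - by have := pos _ b'1; lra.
    - by have := cbound _ b'2; lra.
  have b1 : b = 1%N by move: b0 b2; clear; lia.
  have e0 : 0 <= e.
    rewrite leNgt; apply/negP => e0; apply: (viol 0%N) => //.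
    - by rewrite h0 b1 subn0 mul1n add0n qM0.
    - by rewrite mul0r sub0r oppr_gt0.
    - by have := cbound 0%N (ltnW ca); lra.
  have [z|[_ [t [tz tn]]]|[e0' _]] :=
    oerr_trichotomy alpha01 alphaI adm Kz M.+1.
  - exfalso; have z1 : n1 = 0%N by apply: otail_zero.
    move: hE; rewrite h0 b1 z1 mul1n addn0 add0n => hE.
    by move: mn; rewrite -hE leqNgt qm.
  - constructor 2; exists M, t; split=> //; last by rewrite addn1.
    move=> k [kM|kM]; first exact: (ohead_eq0 alpha01 alphaI h0).
    by apply: tz; move: kM; clear; lia.
  - by exfalso; move: e0'; rewrite -/e; lra.
(* Now [h > 0] keeps [k] positive, so [b'] may reach [b]. *)
exfalso; pose b' := minn b (a M.+1 - c.+1).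
have b'1 : (0 < b')%N by move: b0 ca; rewrite /b'; clear; lia.
have b'2 : (b' + c.+1 <= a M.+1)%N by move: ca; rewrite /b'; clear; lia.
apply: (viol b').
- exact: geq_minl.
- rewrite addn_gt0 h0 /=.
  (* For [b = a_(M+1)] the difference [b - b'] is [c + 1], and [k < m] because the preceding digit
     vanishes, whence [h < q M]. *)
  move: ba; rewrite leq_eqVlt => /orP[/eqP ba|ba].
    have M0 : (0 < M)%N.
      by rewrite lt0n; apply/eqP => M0; move: h0; rewrite /h M0 /ohead big_geq.
    have hq : (h < q M)%N.
      move: (ba); rewrite /h /b; case: (M) M0 => // M' _ ba'; rewrite oheadS.
      case: (adm) => _ _ /(_ M'.+1 isT ba') /= ->; rewrite mul0n addn0.
      exact: (ohead_lt alpha01 alphaI adm).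
    have -> : (b - b')%N = c.+1 by move: ba ca; rewrite /b'; clear; lia.
    by rewrite mE addnCA -mulSn ltn_add2r.
  apply: (@leq_trans (q M.+1 + c * q M.+1)).
    rewrite -addSn; apply: leq_add => //.
    by apply: mulq; move: ba ca; rewrite /b'; clear; lia.
  by rewrite mE leq_add2l leq_addl.
- by have := pos _ b'1; lra.
- by have := cbound _ b'2; lra.
Qed.

Lemma same_side_shapes m n : (1 < m <= n)%N -> same_side alpha m n ->
  shape_i alpha m n \/ shape_ii alpha m n \/
  shape_iii alpha m n \/ shape_iv alpha m n.
Proof.
move=> m1n ss; case/andP: (m1n) => m1 mn.
have [M [mz mM /andP[]]] := top_digit (ltnW m1).
rewrite leq_eqVlt => /orP[/eqP qm _|qm mq].
  by have [] := avoid_shapes_q m1n (esym qm) mz ss; tauto.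
have qM0 := cf_q_gt0 alpha01 alphaI M.
(* The largest [c] with [q_(M-1) + c q_M < m]: this index and [q_M] are those of the two neighbours
   of 0. *)
pose c := ((m.-1 - q M) %/ q M.+1)%N.
have mD := divn_eq (m.-1 - q M) (q M.+1); rewrite -/c in mD.
have mR := ltn_pmod (m.-1 - q M) qM0.
have qle := cf_q_leS alpha01 alphaI M.
have sm : (q M + c * q M.+1 < m)%N.
  move: mD mR qm qle m1; move: (_ %% _)%N (c * _)%N => x y; clear; lia.
have ms : (m <= q M.+1 + (q M + c * q M.+1))%N.
  move: mD mR qm qle m1; move: (_ %% _)%N (c * _)%N => x y; clear; lia.
have ca : (c < a M.+1)%N.
  move: (ltn_trans sm mq); rewrite cf_qSS addnC ltn_add2r ltn_pmul2r//.
have s0 : (0 < q M + c * q M.+1)%N.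
  case: (posnP M) => [M0|]; last first.
    by case: (M) => // M' _; rewrite addn_gt0 cf_q_gt0.
  by move: ms m1; rewrite M0 -[q 1]/1%N; clear; lia.
(* Equality is the case of two gap lengths, strict inequality that of three. *)
move: ms; rewrite leq_eqVlt => /orP[/eqP mE|ms].
  have ca' : (c.+1 < a M.+1)%N.
    move: mq; rewrite mE addnCA -mulSn cf_qSS [X in (_ < X)%N]addnC.
    by rewrite ltn_add2l ltn_pmul2r.
  by have [] := avoid_shapes m1n mE ca' qm mz mM ss; tauto.
have ss' : same_side (cf_sgn alpha M) m n.
  by apply/(same_side_cf_sgn alpha01 alphaI M) => //; rewrite (ltnW m1).
have [p pE] := same_side_three_gaps (cf_sgn_irr alpha01 alphaI M)
  (cf_qS_cf_sgn alpha M) (cf_q_add_cf_sgn alpha M c)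
  (cf_gap alpha01 alphaI (ltnW ca)) (err_gt0 M.+1)
  (cf_err_sub_gt0 alpha01 alphaI (ltnW ca))
  (introT andP (conj qM0 qm)) (introT andP (conj s0 sm)) ms mn ss'.
have [p' p'E] := norm_sgn_alpha M n p; rewrite p'E in pE.
by have [] := near_shapes mz mM pE; tauto.
Qed.

End Shapes.

Theorem theorem2p1 (R : realType) (alpha theta : R) (m n : nat) :
  (0 < alpha < 1)%R -> irrational alpha -> (0 <= theta < 1)%R ->
  2 <= m -> m <= n ->
  balanced_rectangles (sturmian alpha theta) m n <->
  (shape_i alpha m n \/ shape_ii alpha m n \/
   shape_iii alpha m n \/ shape_iv alpha m n).
Proof.
move=> alpha01 alphaI _ m2 mn.
have m1n : 1 < m <= n by rewrite m2.
rewrite (balanced_iff_same_side alpha01 alphaI); last by rewrite ltnW.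
split; first exact: same_side_shapes.
case=> [|[|[|]]].
- exact: shape_i_same_side.
- exact: shape_ii_same_side.
- exact: shape_iii_same_side.
- exact: shape_iv_same_side.
Qed.
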